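(* Let $\alpha\neq -1,-2,\ldots$ be a real number and let $\mathcal F=(F_1,F_2)$ be a pair of finite sets of positive integers (not both empty), with $k=|F_1|+|F_2|$. If $\alpha+1$ and $\mathcal F$ are admissible, then $\alpha+k>-1$ and the polynomial $\Omega_{\mathcal F}^\alpha$ does not vanish in $[0,+\infty)$.
   Context: $\mathbb N=\{0,1,2,\ldots\}$; $(y)_j=y(y+1)\cdots(y+j-1)$, $(y)_0=1$. Laguerre polynomials: $L_n^\alpha(x)=\sum_{j=0}^n\frac{(-x)^j}{j!}\binom{n+\alpha}{n-j}$. For a pair $\mathcal F=(F_1,F_2)$ with $k=|F_1|+|F_2|$, $\Omega_{\mathcal F}^\alpha(x)$ is the determinant of the $k\times k$ matrix with columns indexed by $j=0,\ldots,k-1$ whose rows are $\big((L_f^\alpha)^{(j)}(x)\big)_j$ ($j$-th derivatives) for $f\in F_1$ (increasing order), followed by $\big(L_f^{\alpha+j}(-x)\big)_j$ for $f\in F_2$ (increasing order). Admissibility: for a real $c\neq 0,-1,-2,\ldots$ put $\hat c=\max\{-[c],0\}$, where $[c]$ is the integral part (floor) of $c$. The number $c$ and the pair $\mathcal F$ are admissible if for all $x\in\mathbb N$ $$\frac{\prod_{f\in F_1}(x-f)\prod_{f\in F_2}(x+c+f)}{(x+c)_{\hat c}}\ge 0 .$$ Here this is applied with $c=\alpha+1$. *)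

(* Defs.v *)
From mathcomp Require Import all_boot all_order all_algebra.
From mathcomp Require Import finmap.
From mathcomp Require Import reals.

Set Implicit Arguments.
Unset Strict Implicit.
Unset Printing Implicit Defensive.

Import Order.TTheory GRing.Theory Num.Theory.
Local Open Scope fset_scope.
Local Open Scope ring_scope.

Section LaguerreWronskian.
Variable R : realType.
Implicit Types (y c alpha : R) (n m : nat) (F : {fset nat}).

Definition pochhammer y n : R := \prod_(i < n) (y + i%:R).

Definition gbinom y m : R := (\prod_(i < m) (y - i%:R)) / (m`!)%:R.

Definition laguerre alpha n : {poly R} :=
  \sum_(j < n.+1)
    (((j : nat)`!)%:R^-1 * gbinom (n%:R + alpha) (n - j)) *: (- 'X) ^+ j.

Definition fset_nth F (i : nat) : nat := nth 0%N (sort leq F) i.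

Definition laguerre_mx alpha (F1 F2 : {fset nat}) :
    'M[{poly R}]_(#|` F1| + #|` F2|) :=
  col_mx
    (\matrix_(i < #|` F1|, j < #|` F1| + #|` F2|)
       (laguerre alpha (fset_nth F1 i))^`(j))
    (\matrix_(i < #|` F2|, j < #|` F1| + #|` F2|)
       (laguerre (alpha + j%:R) (fset_nth F2 i) \Po (- 'X))).

Definition Omega alpha (F1 F2 : {fset nat}) : {poly R} :=
  \det (laguerre_mx alpha F1 F2).

Definition chat c : nat := `|Num.max (- Num.floor c) 0|%N.

(* Meant for c different from 0, -1, -2, ...: the denominator is then nonzero
   for every x. *)
Definition admissible c (F1 F2 : {fset nat}) : Prop :=
  forall x : nat,
    0 <= (\prod_(f <- F1) (x%:R - f%:R)) * (\prod_(f <- F2) (x%:R + c + f%:R))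
         / pochhammer (x%:R + c) (chat c).

End LaguerreWronskian.

(* Main.v *)
Require Import Defs.
From mathcomp Require Import all_boot all_order all_algebra.
From mathcomp Require Import finmap.
From mathcomp Require Import perm reals polyrcf ring lra.

Set Implicit Arguments.
Unset Strict Implicit.
Unset Printing Implicit Defensive.

Import Order.TTheory GRing.Theory Num.Theory.
Local Open Scope fset_scope.
Local Open Scope ring_scope.

(** Put [c = alpha + 1]. The rows of [Omega] are limits, as [s] tends to
    infinity and [e = x / s], of rows of Meixner polynomials of degrees
    [s], ..., [s + k - 1] evaluated at the nodes [f] for [f] in [F1] and
    [- c - f] for [f] in [F2]. If the determinant of the latter vanished, some
    combination of these polynomials would be divisible by the polynomial
    [lambda] with these nodes as roots, with a quotient [T] of degree less than
    [s]; by orthogonality [lambda * T ^+ 2] would have zero sum against the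
    Meixner weight [(c)_n / (n! (1 + e)^n)], whereas admissibility says that
    [lambda] times this weight has constant sign. Hence the determinants keep
    the sign that they have at [e = 0], and in the limit [Omega] is nonzero at
    [0] and does not change sign on the positive half-line. Zeros at [x > 0] are
    excluded by induction on their multiplicity, over all admissible families
    of nodes.

    For the bound on [alpha]: if [k < chat c], the finite difference of order
    [chat c] of [lambda] vanishes although its terms have the same sign. *)

(** * Binomial transforms and finite differences *)

Section BinomialTransform.
Variable K : comNzRingType.
Implicit Types (e : K) (u : nat -> K) (s l : nat).

(** With [E] the shift of sequences, this is [(1 + e E)^s u] at [l]. Applied to [node_poly c] with
    [l = 0], it is the Meixner polynomial of degree [s] for the parameter [1 / (1 + e)]. *)
Definition bintr e u s l : K :=
  \sum_(j < s.+1) 'C(s, j)%:R * e ^+ j * u (l + j)%N.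

Lemma bintr0 e u l : bintr e u 0 l = u l.
Proof. by rewrite /bintr big_ord1 bin0 expr0 addn0 !mul1r. Qed.

Lemma bintr_at0 u s l : bintr 0 u s l = u l.
Proof.
rewrite /bintr big_ord_recl bin0 expr0 addn0 !mul1r big1 ?addr0 // => i _.
by rewrite lift0 expr0n mulr0 mul0r.
Qed.

Lemma bintrS e u s l : bintr e u s.+1 l = bintr e u s l + e * bintr e u s l.+1.
Proof.
rewrite /bintr big_ord_recl bin0.
rewrite [X in _ + X = _](eq_bigr (fun i : 'I_s.+1 => 'C(s, i.+1)%:R * e ^+ i.+1 * u (l + i.+1)%N +
    'C(s, i)%:R * e ^+ i.+1 * u (l + i.+1)%N)); last first.
  by move=> i _; rewrite lift0 binS natrD 2!mulrDl.
rewrite big_split /= addrA; congr (_ + _); last first.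
  rewrite mulr_sumr; apply: eq_bigr => i _.
  by rewrite exprS addSnnS !mulrA [e * _]mulrC.
rewrite [in RHS]big_ord_recl bin0 big_ord_recr /= bin_small // !mul0r addr0.
by congr (_ + _).
Qed.

Lemma eq_bintr e u v s l : u =1 v -> bintr e u s l = bintr e v s l.
Proof. by move=> uv; apply: eq_bigr => j _; rewrite uv. Qed.

Lemma bintrB e u v s l :
  bintr e (fun m => u m - v m) s l = bintr e u s l - bintr e v s l.
Proof. by rewrite /bintr -sumrB; apply: eq_bigr => j _; rewrite mulrBr. Qed.

Lemma bintrZ e a u s l : bintr e (fun m => a * u m) s l = a * bintr e u s l.
Proof. by rewrite /bintr mulr_sumr; apply: eq_bigr => j _; rewrite mulrCA. Qed.

Lemma bintr_shift e u s l : bintr e (fun m => u m.+1) s l = bintr e u s l.+1.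
Proof. by []. Qed.

Lemma size_shift_sub (q : {poly K}) :
  (size (q \Po ('X + 1) - q)%R <= (size q).-1)%N.
Proof.
elim/poly_ind: q => [|p a IH]; first by rewrite comp_poly0 subr0 size_poly0.
have [->|p0] := eqVneq p 0.
  by rewrite mul0r add0r comp_polyC subrr size_poly0.
rewrite size_MXaddC (negPf p0) /= comp_poly_MXaddC.
have -> : (p \Po ('X + 1)) * ('X + 1) + a%:P - (p * 'X + a%:P) =
  (p \Po ('X + 1) - p) * 'X + (p \Po ('X + 1)) by ring.
apply: (leq_trans (size_polyD _ _)); rewrite geq_max; apply/andP; split.
  apply: leq_trans (size_polyMleq _ _) _; rewrite size_polyX addn2 /=.
  by rewrite -[leqRHS]prednK ?ltnS // size_poly_gt0.
have := size_comp_poly_leq p ('X + 1).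
rewrite (_ : size ('X + 1 : {poly K}) = 2); last by rewrite -polyC1 size_XaddC.
by rewrite muln1 prednK ?size_poly_gt0.
Qed.

(* With [e = -1] the binomial transform is, up to sign, an iterated finite
   difference. *)
Lemma bintr_horner0 (q : {poly K}) s l :
  (size q <= s)%N -> bintr (-1) (fun m => q.[m%:R]) s l = 0.
Proof.
elim: s q l => [|s IH] q l.
  by rewrite leqn0 size_poly_eq0 => /eqP ->; rewrite bintr0 horner0.
move=> sq; rewrite bintrS mulN1r -bintr_shift -bintrB.
rewrite (eq_bintr _ (v := fun m => - 1 * (q \Po ('X + 1) - q).[m%:R])).
  rewrite bintrZ IH ?mulr0 // (leq_trans (size_shift_sub _)) //.
  by rewrite -ltnS; case: (size q) sq.
by move=> m; rewrite !hornerE horner_comp !hornerE mulN1r opprB -natr1.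
Qed.

(** Makes the number of terms independent of [s], for the limit in [s]: the binomials vanish beyond
    [s] and [u] vanishes from [n] on. *)
Lemma bintr_trunc e u s n : (forall m, (n <= m)%N -> u m = 0) ->
  bintr e u s 0 = \sum_(j < n) 'C(s, j)%:R * e ^+ j * u j.
Proof.
pose F j := 'C(s, j)%:R * e ^+ j * u j => u0.
have widen N M : (N <= M)%N -> (forall j, (N <= j)%N -> F j = 0) ->
    \sum_(j < N) F j = \sum_(j < M) F j.
  move=> NM F0; rewrite (big_ord_widen M F NM) big_mkcond.
  by apply: eq_bigr => j _; case: ltnP => // /F0.
rewrite -[RHS]/(\sum_(j < n) F j) (widen n (maxn n s.+1)) ?leq_maxl //.
  rewrite -(widen s.+1) ?leq_maxr // => j sj.
  by rewrite /F bin_small // !mul0r.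
by move=> j nj; rewrite /F u0 ?mulr0.
Qed.

End BinomialTransform.

(* The hypothesis says that [h l i] is the [i]-th forward difference at [l] of
   [h^~ 0]; this is Euler's transformation of the binomial sum. *)
Lemma bintr_euler (K : fieldType) (e : K) (h : nat -> nat -> K) s l :
  1 + e != 0 -> (forall l i, h l i.+1 = h l.+1 i - h l i) ->
  bintr e (h^~ 0%N) s l = (1 + e) ^+ s * bintr (e / (1 + e)) (h l) s 0.
Proof.
move=> e1 hS; elim: s l => [|s IH] l; first by rewrite !bintr0 mul1r.
rewrite bintrS !IH bintrS -bintr_shift (eq_bintr _ _ _ (hS l)) bintrB exprS.
by field.
Qed.

Lemma rmorph_bintr (K K' : comNzRingType) (f : {rmorphism K -> K'}) e u s l :
  f (bintr e u s l) = bintr (f e) (f \o u) s l.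
Proof.
rewrite /bintr rmorph_sum; apply: eq_bigr => j _.
by rewrite !rmorphM rmorphXn rmorph_nat.
Qed.

(** * Summation against the Meixner weight *)

Section Telescoping.
Variables (K : fieldType) (c e : K).
Hypothesis c_neq : forall n, c + n%:R != 0.
Hypothesis e_neq0 : e != 0.
Implicit Types (P T q : {poly K}) (m s l : nat).

(* The right-hand sides are, up to a constant, the polynomials [P] for which
   [P n * w n] is the forward difference of [n * S n * w n], where
   [w n = (c)_n / (n! (1 + e)^n)] is the Meixner weight. *)
Definition telescoping P : Prop := exists S : {poly K},
  P = ('X + c%:P) * (S \Po ('X + 1)) - (1 + e) *: ('X * S).

Lemma telescoping0 : telescoping 0.
Proof. by exists 0; rewrite comp_poly0 !mulr0 scaler0 subrr. Qed.

Lemma telescopingD P T : telescoping P -> telescoping T -> telescoping (P + T).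
Proof.
move=> [S ->] [S' ->]; exists (S + S'); rewrite comp_polyD !mulrDr scalerDr.
by rewrite opprD addrACA.
Qed.

Lemma telescopingZ a P : telescoping P -> telescoping (a *: P).
Proof.
move=> [S ->]; exists (a *: S); rewrite comp_polyZ -!scalerAr scalerBr.
by rewrite !scalerA [a * _]mulrC.
Qed.

Lemma telescoping_sum n (F : 'I_n -> {poly K}) :
  (forall i, telescoping (F i)) -> telescoping (\sum_i F i).
Proof.
move=> tF; elim/big_rec: _ => [|i P _]; first exact: telescoping0.
exact: telescopingD.
Qed.

(** This is [(-X)_m / (c)_m], the [X]-dependent factor of the hypergeometric series of Meixner
    polynomials. *)
Definition node_poly m : {poly K} :=
  \prod_(i < m) ((c + i%:R)^-1 *: (i%:R%:P - 'X)).

Lemma node_poly0 : node_poly 0 = 1. Proof. by rewrite /node_poly big_ord0. Qed.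

Lemma node_polyS m :
  (c + m%:R) *: node_poly m.+1 = node_poly m * (m%:R%:P - 'X).
Proof.
by rewrite /node_poly big_ord_recr /= -scalerAr scalerA divff ?scale1r.
Qed.

Lemma node_poly_shift m :
  'X * (node_poly m \Po ('X - 1)) = - ((c + m%:R) *: node_poly m.+1).
Proof.
elim: m => [|m IH].
  rewrite node_polyS node_poly0 comp_polyC mulr1 mul1r sub0r.
  by rewrite opprK.
apply: (scalerI (c_neq m)); rewrite scalerAr -comp_polyZ (node_polyS m).
rewrite comp_polyM mulrA IH rmorphB /= comp_polyC comp_polyX !node_polyS.
rewrite -natr1 polyCD !polyC1 scalerN scalerAl node_polyS.
by ring.
Qed.

Lemma telescoping_node m : telescoping (node_poly m + e *: node_poly m.+1).
Proof.
suff [S eS]: telescoping ((c + m%:R) *: (node_poly m + e *: node_poly m.+1)).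
  by rewrite -[X in telescoping X](scalerK (c_neq m)); apply: telescopingZ; exists S.
(* For this [S], the shift of [S] is [node_poly m], and [node_poly_shift] makes ['X * S] a multiple
   of [node_poly m.+1]. *)
exists (node_poly m \Po ('X - 1)); rewrite -comp_polyA node_poly_shift.
rewrite comp_polyB comp_polyX -polyC1 comp_polyC addrK comp_polyXr.
have := node_polyS m; rewrite -!mul_polyC !polyCD => E.
have -> : ('X + c%:P) * node_poly m = (c%:P + m%:R%:P) * node_poly m -
  node_poly m * (m%:R%:P - 'X) by ring.
by rewrite -E; ring.
Qed.

(* Modulo telescoping polynomials, [node_poly m * T] is the constant
   [(-e)^-m * q.[m]] for a polynomial [q] not larger than [T]. *)
Lemma telescoping_reduce T : exists2 q : {poly K}, (size q <= size T)%N &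
  forall m, telescoping (node_poly m * T - ((- e)^- m * q.[m%:R])%:P).
Proof.
elim/poly_ind: T => [|T a [q sq tq]].
  exists 0 => // m; rewrite horner0 !mulr0 subrr; exact: telescoping0.
have tn m : telescoping (node_poly m - ((- e)^- m)%:P).
  elim: m => [|m IH]; first by rewrite node_poly0 expr0 invr1 subrr; apply: telescoping0.
  have -> : node_poly m.+1 - ((- e)^- m.+1)%:P =
     e^-1 *: ((node_poly m + e *: node_poly m.+1) +
              -1 *: (node_poly m - ((- e)^- m)%:P)).
    have ee : (e^-1)%:P * e%:P = 1 :> {poly K} by rewrite -polyCM mulVf.
    rewrite exprS invfM invrN -!mul_polyC !(polyCN, polyCM) -[LHS]mul1r -ee.
    rewrite mulrBr [X in _ - X](_ : _ =
      - (((e^-1)%:P * e%:P) * ((e^-1)%:P * ((- e)^- m)%:P))); last by ring.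
    by rewrite {2}ee polyC1; ring.
  apply: telescopingZ; apply: telescopingD; first exact: telescoping_node.
  exact: telescopingZ.
(* Read off from [X node_poly m = m node_poly m - (c + m) node_poly m.+1]; the factor [e^-1] comes
   from passing from [(-e)^-(m+1)] to [(-e)^-m]. *)
exists (e^-1 *: (('X + c%:P) * (q \Po ('X + 1))) + 'X * q + a%:P).
  rewrite size_MXaddC; have [T0|T0 /=] := eqVneq T 0.
    move: sq; rewrite T0 size_poly0 leqn0 size_poly_eq0 => /eqP ->.
    rewrite comp_poly0 !mulr0 scaler0 !add0r /=.
    by case: eqVneq => [->|_]; rewrite ?size_poly0 ?size_polyC_leq1.
  apply: leq_trans (size_polyD _ _) _; rewrite geq_max; apply/andP; split; last first.
    by apply: leq_trans (size_polyC_leq1 _) _.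
  have sM (p1 p2 : {poly K}) : size p1 = 2 -> (size p2 <= size T)%N ->
      (size (p1 * p2)%R <= (size T).+1)%N.
    by move=> s1 s2; apply: leq_trans (size_polyMleq _ _) _; rewrite s1 add2n /= ltnS.
  apply: leq_trans (size_polyD _ _) _; rewrite geq_max; apply/andP; split.
    apply: leq_trans (size_scale_leq _ _) _; apply: sM; first exact: size_XaddC.
    by rewrite size_comp_poly2 // -polyC1 size_XaddC.
  by apply: sM => //; exact: size_polyX.
move=> m.
have qE : (e^-1 *: (('X + c%:P) * (q \Po ('X + 1))) + 'X * q + a%:P).[m%:R] =
    e^-1 * ((m%:R + c) * q.[m.+1%:R]) + m%:R * q.[m%:R] + a.
  by rewrite !hornerE horner_comp !hornerE natr1.
rewrite {}qE.
have -> : node_poly m * (T * 'X + a%:P) -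
    ((- e)^- m * (e^-1 * ((m%:R + c) * q.[m.+1%:R]) + m%:R * q.[m%:R] + a))%:P
  = m%:R *: (node_poly m * T - ((- e)^- m * q.[m%:R])%:P) +
   ((- (c + m%:R)) *: (node_poly m.+1 * T - ((- e)^- m.+1 * q.[m.+1%:R])%:P) +
    a *: (node_poly m - ((- e)^- m)%:P)).
  have := node_polyS m.
  rewrite exprS invfM invrN -!mul_polyC !(polyCN, polyCM, polyCD) => E.
  have -> : node_poly m * (T * 'X + a%:P) = m%:R%:P * (node_poly m * T) -
    (node_poly m * (m%:R%:P - 'X)) * T + a%:P * node_poly m by ring.
  rewrite -E; ring.
by do !apply: telescopingD; apply: telescopingZ.
Qed.

(** Orthogonality to lower degrees: modulo telescoping polynomials, the product is a constant
    multiple of the [s]-th finite difference of a polynomial [q] of degree less than [s], which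
    vanishes. *)
Lemma telescoping_bintr s l T : (size T <= s)%N ->
  telescoping (bintr e%:P node_poly s l * T).
Proof.
move=> sT; have [q sq tq] := telescoping_reduce T.
have -> : bintr e%:P node_poly s l * T = \sum_(j < s.+1) ('C(s, j)%:R * e ^+ j) *:
     (node_poly (l + j) * T - ((- e)^- (l + j) * q.[(l + j)%:R])%:P).
  under [RHS]eq_bigr => j _ do rewrite scalerBr.
  rewrite sumrB [X in _ = _ - X](_ : _ = 0).
    rewrite subr0 /bintr mulr_suml; apply: eq_bigr => j _.
    by rewrite -mulrA -mul_polyC polyCM polyC_natr polyC_exp mulrA.
  have := bintr_horner0 l (leq_trans sq sT); rewrite /bintr => E.
  transitivity (((- e)^- l *
     \sum_(j < s.+1) 'C(s, j)%:R * (-1) ^+ j * q.[(l + j)%:R])%:P).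
    rewrite mulr_sumr rmorph_sum; apply: eq_bigr => j _ /=.
    rewrite -mul_polyC -polyCM; congr (_%:P).
    rewrite exprD invfM [X in _ * (_ * X * _)](_ : _ = (-1) ^+ j * e ^- j).
      have : e ^+ j * e ^- j = 1 by rewrite divff // expf_neq0.
      move: (e ^+ j) (e ^- j) => x y xy.
      transitivity (x * y * ('C(s, j)%:R * (-1) ^+ j * q.[(l + j)%:R] * (- e) ^- l)).
        by ring.
      by rewrite xy mul1r mulrC.
    by rewrite (exprNn e) invfM -exprVn invrN1.
  by rewrite E mulr0.
by apply: telescoping_sum => i; apply: telescopingZ.
Qed.

End Telescoping.

(** * Nonvanishing of the Meixner determinants *)

Section Nondegeneracy.
Variables (R : realType) (c : R).
Hypothesis c_neq : forall n, c + n%:R != 0.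

Lemma pochhammerS (y : R) n :
  pochhammer y n.+1 = pochhammer y n * (y + n%:R).
Proof. by rewrite /pochhammer big_ord_recr. Qed.

Lemma pochhammer0 (y : R) : pochhammer y 0 = 1.
Proof. by rewrite /pochhammer big_ord0. Qed.

Lemma size_node_poly m : size (node_poly c m) = m.+1.
Proof.
elim: m => [|m IH]; first by rewrite node_poly0 size_poly1.
have := congr1 (fun p : {poly R} => size p) (node_polyS c_neq m).
rewrite size_scale // => ->; rewrite -[_%:P - _]opprB mulrN size_polyN.
have n0 : node_poly c m != 0 by rewrite -size_poly_gt0 IH.
by rewrite size_Mmonic ?monicXsubC // IH size_XsubC addn2.
Qed.

Lemma size_bintr_node e s l : e != 0 ->
  size (bintr e%:P (node_poly c) s l) = (s + l).+1.
Proof.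
move=> e0; elim: s l => [|s IH] l; first by rewrite bintr0 size_node_poly.
by rewrite bintrS addrC mul_polyC size_polyDl size_scale // !IH ?addnS.
Qed.

(** The leading terms of [X S(X + 1)] and [(1 + e) X S] differ by that of [-e X S]; everything else
    has lower degree. *)
Lemma lead_coef_telescoping e (S : {poly R}) : e != 0 ->
  lead_coef (('X + c%:P) * (S \Po ('X + 1)) - (1 + e) *: ('X * S)) =
  - e * lead_coef S.
Proof.
move=> e0; have [->|S0] := eqVneq S 0.
  by rewrite comp_poly0 !mulr0 scaler0 subrr !lead_coef0 mulr0.
have -> : ('X + c%:P) * (S \Po ('X + 1)) - (1 + e) *: ('X * S) =
  - e *: ('X * S) + ('X * (S \Po ('X + 1) - S) + c *: (S \Po ('X + 1))).
  by rewrite -!mul_polyC polyCD polyCN; ring.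
have sXS : size (- e *: ('X * S)) = (size S).+1.
  by rewrite size_scale ?oppr_eq0 // mulrC size_mulX.
rewrite lead_coefDl.
  by rewrite lead_coefZ ['X * S]mulrC lead_coefMX.
rewrite sXS ltnS; apply: leq_trans (size_polyD _ _) _; rewrite geq_max.
apply/andP; split.
  apply: leq_trans (size_polyMleq _ _) _; rewrite size_polyX add2n /=.
  apply: (@leq_trans (size S).-1.+1); first by rewrite ltnS size_shift_sub.
  by rewrite prednK // size_poly_gt0.
apply: leq_trans (size_scale_leq _ _) _.
by rewrite size_comp_poly2 // -polyC1 size_XaddC.
Qed.

Variables (kap : R) (p : nat).
Hypothesis kap_tail : forall n, (p <= n)%N -> 0 < kap * pochhammer c n.

(** The weighted sum of [P] up to [N] telescopes to a boundary term in [S(N)]. A positive leading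
    coefficient of [P] would make [S(N)] negative for large [N], hence a sum of nonnegative terms
    negative. *)
Lemma lead_coef_telescoping_le0 e P : 0 < e -> telescoping c e P ->
  (forall n : nat, 0 <= kap * pochhammer c n * P.[n%:R]) -> lead_coef P <= 0.
Proof.
move=> e0 [S PE] Pge0; rewrite leNgt; apply/negP.
rewrite PE lead_coef_telescoping ?gt_eqF // mulNr -mulrN pmulr_rgt0 //.
rewrite -lead_coefN => /[dup] lS /poly_pinfty_gt_lc [b Sb].
pose w n := pochhammer c n / (n`!%:R * (1 + e) ^+ n).
have e1 : 1 + e != 0 by rewrite gt_eqF // addr_gt0.
have wS n : w n.+1 * n.+1%:R * (1 + e) = (c + n%:R) * w n.
  rewrite /w pochhammerS factS natrM exprS.
  by field; rewrite e1 expf_neq0 // nat1r !pnatr_eq0 -lt0n fact_gt0.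
have sumP N : \sum_(n < N) w n * P.[n%:R] = (1 + e) * (w N * N%:R * S.[N%:R]).
  elim: N => [|N IH]; first by rewrite big_ord0 mulr0 mul0r mulr0.
  rewrite big_ord_recr /= {}IH PE -polyC1.
  rewrite !(hornerD, hornerN, hornerM, hornerZ, hornerX, hornerC, horner_comp) natr1.
  transitivity ((c + N%:R) * w N * S.[N.+1%:R]); first by ring.
  by rewrite -wS; ring.
have [N] : exists N : nat, b <= N%:R /\ (maxn p 1 <= N)%N.
  exists (maxn (Num.truncn `|b|).+1 (maxn p 1)); split; last exact: leq_maxr.
  apply: le_trans (ler_norm b) _; apply: ltW.
  by apply: lt_le_trans (truncnS_gt _) _; rewrite ler_nat leq_maxl.
rewrite geq_max => -[bN /andP[pN N0]].
have : 0 <= kap * \sum_(n < N) w n * P.[n%:R].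
  rewrite mulr_sumr sumr_ge0 // => n _; rewrite /w mulrA.
  rewrite [X in 0 <= X](_ : _ = kap * pochhammer c n * P.[n%:R] /
     (n`!%:R * (1 + e) ^+ n)); last by ring.
  by rewrite divr_ge0 // mulr_ge0 // exprn_ge0 // addr_ge0 // ltW.
rewrite sumP leNgt => /negP; apply.
have SN : S.[N%:R] < 0.
  by rewrite -oppr_gt0 -hornerN (lt_le_trans lS) // Sb.
rewrite [X in X < 0](_ : _ = kap * pochhammer c N * ((1 + e) * N%:R /
     (N`!%:R * (1 + e) ^+ N)) * S.[N%:R]); last by rewrite /w; ring.
rewrite pmulr_rlt0 // mulr_gt0 ?kap_tail // divr_gt0 ?mulr_gt0 ?exprn_gt0 //.
all: by rewrite ?ltr0n ?fact_gt0 // addr_gt0.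
Qed.

Variables (nu : nat -> R) (k : nat).
Hypothesis nu_inj : {in [pred i | (i < k)%N] &, injective nu}.

Definition root_poly : {poly R} := \prod_(i < k) ('X - (nu i)%:P).

Lemma size_root_poly : size root_poly = k.+1.
Proof. by rewrite /root_poly -big_enum size_prod_XsubC size_enum_ord. Qed.

Hypothesis adm : forall n : nat, 0 <= kap * pochhammer c n * root_poly.[n%:R].

Lemma det_bintr_neq0 e s : 0 < e ->
  \det (\matrix_(i < k, j < k) (bintr e%:P (node_poly c) s j).[nu i]) != 0.
Proof.
move=> e0; have e_neq0 : e != 0 by rewrite gt_eqF.
(* After transposition the kernel vector combines the polynomials rather than the nodes. *)
rewrite -det_tr; apply/negP => /det0P[v v0 vA].
pose Q := \sum_(j < k) v 0 j *: bintr e%:P (node_poly c) s j.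
have Q0 : Q != 0.
  have /rV0Pn[j0 vj0] := v0.
  (* The [j]-th polynomial has degree [s + j], so the last nonzero coefficient of [v] fixes the
     degree of [Q]. *)
  have [j vj jmax] := @arg_maxnP _ j0 (fun j => v 0 j != 0) (fun j => j : nat) vj0.
  apply/eqP => /(congr1 (fun P : {poly R} => P`_(s + j))).
  rewrite coef0 coef_sum (bigD1 j) //= big1 ?addr0.
    rewrite coefZ => /eqP; rewrite mulf_eq0 (negPf vj) /=; apply/negP.
    have := size_bintr_node s j e_neq0 => sB.
    have := lead_coef_eq0 (bintr e%:P (node_poly c) s j).
    by rewrite lead_coefE sB /= => ->; rewrite -size_poly_eq0 sB.
  move=> i ij; rewrite coefZ; have [->|vi] := eqVneq (v 0 i) 0; first by rewrite mul0r.
  rewrite nth_default ?mulr0 // size_bintr_node // -addnS leq_add2l.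
  by rewrite ltn_neqAle; apply/andP; split; [exact: ij | exact: jmax].
have rp : root_poly = \prod_(z <- [seq nu i | i <- iota 0 k]) ('X - z%:P).
  by rewrite big_map -[k in iota 0 k]subn0 big_mkord.
have : root_poly %| Q.
  rewrite rp; apply: uniq_roots_dvdp; last first.
    rewrite uniq_rootsE map_inj_in_uniq ?iota_uniq // => i j.
    by rewrite !mem_iota => ik jk; apply: nu_inj.
  apply/allP => z /mapP[i]; rewrite mem_iota add0n => /= ik -> {z}.
  apply/rootP; rewrite /Q horner_sum.
  have := congr1 (fun M : 'rV_k => M 0 (Ordinal ik)) vA; rewrite !mxE => E.
  by rewrite -[RHS]E; apply: eq_bigr => j _; rewrite !mxE hornerZ.
case/dvdpP => T QE.
have T0 : T != 0 by apply: contraNneq Q0 => T0; rewrite QE T0 mul0r.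
have rm : root_poly \is monic by apply: monic_prod => i _; exact: monicXsubC.
have sT : (size T <= s)%N.
  have : (size Q <= s + k)%N.
    apply: leq_trans (size_sum _ _ _) _; apply/bigmax_leqP => j _.
    apply: leq_trans (size_scale_leq _ _) _.
    by rewrite size_bintr_node // -addnS leq_add2l.
  by rewrite QE size_Mmonic // size_root_poly addnS /= leq_add2r.
have tQT : telescoping c e (Q * T).
  rewrite /Q mulr_suml; apply: telescoping_sum => j; rewrite -scalerAl.
  by apply: telescopingZ; apply: telescoping_bintr.
have := lead_coef_telescoping_le0 e0 tQT; rewrite QE => H.
have : lead_coef (T * root_poly * T) <= 0.
  apply: H => n; rewrite !hornerM.
  rewrite [X in 0 <= X](_ : _ =
    kap * pochhammer c n * root_poly.[n%:R] * T.[n%:R] ^+ 2); last by ring.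
  by rewrite mulr_ge0 ?sqr_ge0.
rewrite !lead_coefM (monicP rm) mulr1 leNgt => /negP; apply.
by rewrite -expr2 exprn_even_gt0 //= lead_coef_eq0.
Qed.

End Nondegeneracy.

(** * Laguerre polynomials *)

Section LaguerrePolynomials.
Variable R : realType.
Implicit Types (a x : R) (n m j l : nat) (sd : bool * nat).

Lemma pochhammerSl a n : pochhammer a n.+1 = a * pochhammer (a + 1) n.
Proof.
rewrite /pochhammer big_ord_recl addr0; congr (_ * _).
by apply: eq_bigr => i _; rewrite lift0 -addrA nat1r.
Qed.

Lemma gbinom_pochhammer a m : gbinom (a + m%:R) m = pochhammer (a + 1) m / m`!%:R.
Proof.
rewrite /gbinom /pochhammer (reindex_inj rev_ord_inj) /=; congr (_ / _).
by apply: eq_bigr => i _; rewrite natrB // -natr1; ring.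
Qed.

Lemma coef_laguerre a n j : (laguerre a n)`_j =
  if (j <= n)%N then (-1) ^+ j / j`!%:R *
    (pochhammer (a + 1 + j%:R) (n - j) / (n - j)`!%:R) else 0.
Proof.
have -> : laguerre a n = \poly_(i < n.+1) ((-1) ^+ i / i`!%:R *
    (pochhammer (a + 1 + i%:R) (n - i) / (n - i)`!%:R)); last by rewrite coef_poly ltnS.
rewrite poly_def; apply: eq_bigr => i _.
rewrite (exprNn 'X) (_ : (-1) ^+ i = ((-1) ^+ i)%:P :> {poly R}); last by rewrite polyC_exp polyCN.
rewrite mul_polyC scalerA.
congr (_ *: _); have in' : (i <= n)%N by rewrite -ltnS.
rewrite (_ : n%:R + a = a + i%:R + (n - i)%:R); last by rewrite natrB //; ring.
by rewrite gbinom_pochhammer (addrAC a); ring.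
Qed.

Lemma coef_laguerreS a n j : (j < n)%N -> (laguerre a n)`_j.+1 * j.+1%:R =
  (-1) ^+ j.+1 / j`!%:R * (pochhammer (a + 2 + j%:R) (n - j.+1) / (n - j.+1)`!%:R).
Proof.
move=> jn; rewrite coef_laguerre jn factS natrM invfM.
rewrite (_ : a + 1 + j.+1%:R = a + 2 + j%:R); last by rewrite -natr1; ring.
by field; rewrite nat1r !pnatr_eq0 -!lt0n !fact_gt0.
Qed.

Lemma derivS_laguerre a n : (laguerre a n.+1)^`() = - laguerre (a + 1) n.
Proof.
apply/polyP => j; rewrite coef_deriv coefN -mulr_natr.
have [jn|nj] := leqP j n; last first.
  by rewrite !coef_laguerre ltnS leqNgt nj mul0r oppr0.
rewrite coef_laguerreS ?ltnS // coef_laguerre jn subSS exprS.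
by rewrite (_ : a + 1 + 1 + j%:R = a + 2 + j%:R); ring.
Qed.

Lemma deriv_laguerre a n :
  (laguerre a n)^`() = laguerre a n - laguerre (a + 1) n.
Proof.
apply/polyP => j; rewrite coef_deriv coefB -mulr_natr.
have [jn|nj|jn] := ltngtP j n; last 1 first.
- by rewrite jn !coef_laguerre ltnn leqnn subnn !pochhammer0 mul0r subrr.
- rewrite coef_laguerreS // !coef_laguerre (ltnW jn).
  rewrite -[(n - j)%N](subnSK jn) pochhammerSl pochhammerS factS natrM.
  set m := (n - j.+1)%N; rewrite [a + 1 + j%:R + 1](_ : _ = a + 2 + j%:R); last by ring.
  rewrite [a + 1 + 1 + j%:R](_ : _ = a + 2 + j%:R); last by ring.
  rewrite exprS; field.
  by rewrite nat1r !pnatr_eq0 -!lt0n !fact_gt0.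
- by rewrite !coef_laguerre [(j < n)%N]ltnNge (ltnW nj) [(j <= n)%N]leqNgt nj mul0r subrr.
Qed.

(** Coefficientwise form of the Laguerre equation; the same recurrence is met by the values of
    [node_poly] at [n]. *)
Lemma coef_laguerre_rec a n j :
  (laguerre a n)`_j.+1 * j.+1%:R * (a + 1 + j%:R) = (laguerre a n)`_j * (j%:R - n%:R).
Proof.
have [jn|nj] := ltnP j n.
  rewrite coef_laguerreS // coef_laguerre (ltnW jn).
  rewrite -(subnSK jn) pochhammerSl factS natrM; set m := (n - j.+1)%N.
  have -> : n%:R = j%:R + m.+1%:R :> R by rewrite -natrD /m subnSK // subnKC // ltnW.
  rewrite [a + 1 + j%:R + 1](_ : _ = a + 2 + j%:R); last by ring.
  rewrite exprS; field.
  by rewrite nat1r !pnatr_eq0 -!lt0n !fact_gt0.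
rewrite [in LHS]coef_laguerre ltnNge nj !mul0r coef_laguerre.
have [jn|_] := leqP j n; last by rewrite mul0r.
by rewrite (_ : j = n) ?subrr ?mulr0 //; apply/eqP; rewrite eqn_leq jn.
Qed.

Lemma laguerre_ode a n :
  'X * (laguerre a n)^`(2) + ((a + 1)%:P - 'X) * (laguerre a n)^`() +
  n%:R%:P * laguerre a n = 0.
Proof.
have dE (q : {poly R}) i : q^`()`_i = q`_i.+1 * i.+1%:R by rewrite coef_deriv mulr_natr.
apply/polyP => j; rewrite coef0 !coefD mulrBl coefB !coefCM !coefXM.
have := coef_laguerre_rec a n j; case: j => [|j] /= cj.
  rewrite dE; move: cj; rewrite mulr1 addr0 !add0r => cj.
  by rewrite subr0 (mulrC (a + 1)) cj; ring.
rewrite !dE.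
transitivity ((laguerre a n)`_j.+2 * j.+2%:R * (a + 1 + j.+1%:R) -
   (laguerre a n)`_j.+1 * (j.+1%:R - n%:R)); last by rewrite cj subrr.
by ring.
Qed.

Lemma laguerreS_contiguous a n :
  laguerre a n.+1 = laguerre (a + 1) n.+1 - laguerre (a + 1) n.
Proof.
have := deriv_laguerre a n.+1; rewrite derivS_laguerre => /eqP.
by rewrite eq_sym subr_eq => /eqP ->; rewrite addrC.
Qed.

Lemma laguerre_ode_contiguous a n :
  'X * laguerre (a + 2) n - ((a + 1)%:P + 'X) * laguerre (a + 1) n +
  (a + 1 + n%:R)%:P * laguerre a n = 0.
Proof.
rewrite -[RHS](laguerre_ode a n) -[_^`(2)]/(_^`()^`()) deriv_laguerre derivB.
rewrite !deriv_laguerre -[a + 1 + 1]addrA -[1 + 1]/(2) (polyCD (a + 1)).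
ring.
Qed.

(** The difference of the differential equation in degree [n.+1] and the contiguous relation in
    degree [n], once [derivS_laguerre] has brought both to degree [n]. *)
Lemma laguerre_raise a n : n.+1%:R *: laguerre a n.+1 =
  (n.+1%:R + a) *: laguerre a n - 'X * laguerre (a + 1) n.
Proof.
have := laguerre_ode_contiguous a n; have := laguerre_ode a n.+1.
rewrite -[_^`(2)]/(_^`()^`()) derivS_laguerre derivN deriv_laguerre.
rewrite -[a + 1 + 1]addrA -[1 + 1]/(2) -!mul_polyC => E1 E2.
have comb (p q A B : {poly R}) : A = 0 -> B = 0 -> p - q = A - B -> p = q.
  by move=> -> -> /eqP; rewrite subrr subr_eq0 => /eqP.
by apply: comb E1 E2 _; rewrite -!natr1 !polyCD; ring.
Qed.

End LaguerrePolynomials.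

(** * Relations within the rows of the Wronskian *)

Section SeedRows.
Variables (R : realType) (alpha : R).
Implicit Types (x : R) (n m j l : nat) (sd : bool * nat).

(* [(false, f)] stands for [f] in [F1] and [(true, f)] for [f] in [F2]. *)
Definition seed_row sd j : {poly R} :=
  if sd.1 then laguerre (alpha + j%:R) sd.2 \Po (- 'X)
  else (laguerre alpha sd.2)^`(j).

Definition seed_node sd : R := if sd.1 then - (alpha + 1) - sd.2%:R else sd.2%:R.

Lemma size_laguerre (a : R) n : (size (laguerre a n) <= n.+1)%N.
Proof.
apply/leq_sizeP => j nj; rewrite coef_laguerre leqNgt.
by case: leqP nj.
Qed.

Lemma size_seed_row sd j : (size (seed_row sd j) <= sd.2.+1)%N.
Proof.
rewrite /seed_row; case: sd => [[|]] f /=.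
  by rewrite size_comp_poly2 ?size_laguerre // size_polyN size_polyX.
apply/leq_sizeP => i fi; rewrite coef_derivn nth_default ?mul0rn //.
by apply: leq_trans (size_laguerre alpha f) (leq_trans fi (leq_addl _ _)).
Qed.

Lemma deriv_seed_row sd j :
  (seed_row sd j)^`() = seed_row sd j.+1 - sd.1%:R *: seed_row sd j.
Proof.
rewrite /seed_row; case: sd => [[|]] f /=; last by rewrite scale0r subr0.
rewrite deriv_comp deriv_laguerre derivN derivX mulrN1 comp_polyB opprB scale1r.
by rewrite -natr1 addrA.
Qed.

(** One relation along the columns for both kinds of seeds, which enter only through their nodes:
    the Laguerre equation differentiated [j] times, or the contiguous relation at [-X]. *)
Lemma seed_row_ode sd j :
  'X * seed_row sd j.+2 + ((alpha + 1 + j%:R)%:P - 'X) * seed_row sd j.+1 +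
  (seed_node sd - j%:R)%:P * seed_row sd j = 0.
Proof.
rewrite /seed_row /seed_node; case: sd => [[|]] f /=.
  have := congr1 (fun p => - (p \Po (- 'X))) (laguerre_ode_contiguous (alpha + j%:R) f).
  rewrite comp_poly0 oppr0 => E; rewrite -[RHS]E.
  rewrite comp_polyD comp_polyB !comp_polyM !comp_polyD !comp_polyX !comp_polyC.
  rewrite -(natr1 j.+1) -(natr1 j) !addrA -[_ + 1 + 1]addrA -[1 + 1]/(2).
  by rewrite !polyCD !polyCN !polyCD; ring.
elim: j => [|j IH].
  by rewrite subr0 addr0; exact: laguerre_ode.
have := congr1 (@deriv R) IH; rewrite deriv0 => E; rewrite -[RHS]E.
rewrite !(derivD, derivM, derivN, derivX, derivC) -!derivnS -!natr1.
by rewrite !polyCD !polyCN !polyCD; ring.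
Qed.

(** The classical recurrence in the degree for parameter [alpha], applied to polynomials of
    parameter [alpha + l]; the discrepancy is the term in [l.-1], which has coefficient zero when
    [l = 0]. *)
Lemma seed_row_rec f l :
  f.+2%:R *: seed_row (true, f.+2) l - (2 * f.+1%:R + 1 + alpha) *: seed_row (true, f.+1) l
    + (f.+1%:R + alpha) *: seed_row (true, f) l =
  'X * seed_row (true, f.+1) l + l%:R *: seed_row (true, f.+1) l.-1.
Proof.
rewrite /seed_row /=; set b := alpha + l%:R.
have -> : l%:R *: (laguerre (alpha + l.-1%:R) f.+1 \Po (- 'X)) =
    l%:R *: ((laguerre b f.+1 - laguerre b f) \Po (- 'X)).
  case: l @b => [|l] b; first by rewrite !scale0r.
  by rewrite laguerreS_contiguous /b -natr1 addrA.
have E1 := congr1 (fun p => p \Po (- 'X)) (laguerre_raise b f.+1).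
have E2 := congr1 (fun p => p \Po (- 'X)) (laguerre_raise b f).
have E3 := congr1 (fun p => p \Po (- 'X)) (laguerreS_contiguous b f).
move: E1 E2 E3; rewrite !(comp_polyB, comp_polyM, comp_polyZ, comp_polyX).
have bE : b = alpha + l%:R by [].
move=> E1 E2 E3; rewrite E1.
have E4 : 'X * (laguerre (b + 1) f.+1 \Po - 'X) = 'X * (laguerre b f.+1 \Po - 'X)
  + 'X * (laguerre (b + 1) f \Po - 'X) by rewrite E3; ring.
have E5 : 'X * (laguerre (b + 1) f \Po - 'X) =
   f.+1%:R *: (laguerre b f.+1 \Po - 'X) - (f.+1%:R + b) *: (laguerre b f \Po - 'X).
  by rewrite E2; ring.
rewrite !mulNr opprK E4 E5 bE.
rewrite -!mul_polyC -!natr1 !polyCD !polyCM !polyCD; ring.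
Qed.

(** Two consecutive polynomials cannot both vanish at [x]: the recurrence would carry the zero down
    to degree 0. *)
Lemma seed_row_horner_neq0 x f : (forall n, alpha + n.+1%:R != 0) ->
  exists2 g, (f <= g)%N & (seed_row (true, g) 0).[x] != 0.
Proof.
move=> a0; suff [g gf g0] : exists2 g, (g == f) || (g == f.+1) &
    (seed_row (true, g) 0).[x] != 0.
  by exists g => //; case/orP: gf => /eqP ->.
elim: f => [|f [g gf g0]].
  exists 0 => //; rewrite /seed_row /= /laguerre big_ord1 expr0 comp_polyZ.
  by rewrite /gbinom big_ord0 hornerZ -polyC1 comp_polyC hornerC fact0 divr1 invr1 !mulr1 oner_eq0.
case/orP: gf => /eqP gf; last by exists g; rewrite // gf eqxx.
have [E1|] := eqVneq (seed_row (true, f.+1) 0).[x] 0; last by exists f.+1; rewrite ?eqxx.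
exists f.+2; first by rewrite eqxx orbT.
apply: contra_neq g0 => E2; rewrite gf.
have := congr1 (horner^~ x) (seed_row_rec f 0).
rewrite !(hornerD, hornerN, hornerZ, hornerM) E1 E2 !mulr0 subr0 add0r addr0.
move/eqP; rewrite mulf_eq0 [_ + alpha]addrC (negPf (a0 f)) => /eqP //.
Qed.

End SeedRows.

(** * Limit of the Meixner determinants *)

Lemma det_scale_rows (K : comNzRingType) k (d : 'I_k -> K) (A : 'M[K]_k) :
  \det (\matrix_(i, j) (d i * A i j)) = (\prod_i d i) * \det A.
Proof.
rewrite [X in \det X](_ : _ = diag_mx (\row_i d i) *m A); last first.
  by apply/matrixP => i j; rewrite mul_diag_mx !mxE.
by rewrite det_mulmx det_diag; congr (_ * _); apply: eq_bigr => i _; rewrite mxE.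
Qed.

Lemma horner_det (K : comNzRingType) k (A : 'I_k -> 'I_k -> {poly K}) x :
  (\det (\matrix_(i, j) A i j)).[x] = \det (\matrix_(i, j) (A i j).[x]).
Proof.
rewrite -horner_evalE -det_map_mx; congr (\det _).
by apply/matrixP => i j; rewrite !mxE.
Qed.

Lemma horner_bintr (K : comNzRingType) (e : {poly K}) (u : nat -> {poly K}) s l (y : K) :
  (bintr e u s l).[y] = bintr e.[y] (fun m => (u m).[y]) s l.
Proof. exact: (rmorph_bintr (horner_eval y)). Qed.

Section WeakSign.
Variables (R : realType) (alpha : R).
Hypothesis alpha_neq : forall n, alpha + 1 + n%:R != 0.
Local Notation c := (alpha + 1).
Implicit Types (e x : R) (n m j l s : nat) (sd : bool * nat).

Lemma pochhammer_neq0 n : pochhammer c n != 0.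
Proof. by rewrite /pochhammer prodf_seq_neq0; apply/allP => i _ /=. Qed.

(** The inverse of the value of [laguerre alpha sd.2] at 0. *)
Definition seed_norm sd : R := sd.2`!%:R / pochhammer c sd.2.

Lemma seed_norm_neq0 sd : seed_norm sd != 0.
Proof. by rewrite mulf_neq0 ?invr_eq0 ?pochhammer_neq0 // pnatr_eq0 -lt0n fact_gt0. Qed.

Definition node_val sd m : R := (node_poly c m).[seed_node alpha sd].

Lemma node_valS sd m :
  node_val sd m.+1 = node_val sd m * (m%:R - seed_node alpha sd) / (c + m%:R).
Proof.
have := congr1 (horner^~ (seed_node alpha sd)) (node_polyS alpha_neq m).
rewrite hornerZ hornerM hornerD hornerN hornerX hornerC => <-.
by rewrite mulrC mulKf.
Qed.

(** At a node [f] the value is [(-f)_m / (c)_m], essentially a Laguerre coefficient. At [-c-f] it is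
    [(c+f)_l / (c)_l = (c+l)_f / (c)_f], which gives only the constant coefficient; [bintr_euler]
    later reaches the others. *)
Lemma node_val_coef sd l j :
  node_val sd (if sd.1 then l else l + j) =
    seed_norm sd * ((if sd.1 then 0 else j)`!%:R *
      (seed_row alpha sd l)`_(if sd.1 then 0 else j)).
Proof.
case: sd => [[]] f /=; last first.
  have val m : node_val (false, f) m = seed_norm (false, f) * (m`!%:R * (laguerre alpha f)`_m).
    elim: m => [|m IH].
      rewrite /node_val node_poly0 hornerC coef_laguerre leq0n subn0 addr0 expr0.
      rewrite /seed_norm /= fact0; field.
      by rewrite pochhammer_neq0 pnatr_eq0 -lt0n fact_gt0.
    rewrite node_valS IH /seed_node /= factS natrM.
    have E := coef_laguerre_rec alpha f m; apply: (mulIf (alpha_neq m)).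
    rewrite mulfVK //; transitivity (seed_norm (false, f) * m`!%:R *
      ((laguerre alpha f)`_m * (m%:R - f%:R))); first by ring.
    by rewrite -E; ring.
  rewrite val /seed_row /= coef_derivn -mulr_natr -(ffact_fact (leq_addr j l)).
  by rewrite addKn natrM; ring.
rewrite mul1r.
have c0 m : (laguerre (alpha + m%:R) f \Po (- 'X))`_0 = pochhammer (c + m%:R) f / f`!%:R.
  rewrite -!horner_coef0 horner_comp hornerN hornerX oppr0 horner_coef0.
  by rewrite coef_laguerre leq0n subn0 addr0 expr0 fact0 invr1 !mul1r [c + _]addrAC.
rewrite /seed_row /= c0 /seed_norm /=.
have f0 : f`!%:R != 0 :> R by rewrite pnatr_eq0 -lt0n fact_gt0.
suff -> : node_val (true, f) l = pochhammer (c + l%:R) f / pochhammer c f.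
  by field; rewrite pochhammer_neq0 f0.
elim: l => [|l IH].
  by rewrite /node_val node_poly0 hornerC addr0 divff // pochhammer_neq0.
rewrite node_valS IH /seed_node /=.
have : pochhammer (c + l%:R) f * (c + l%:R + f%:R) = (c + l%:R) * pochhammer (c + l.+1%:R) f.
  by rewrite -pochhammerS pochhammerSl -(addrA c) natr1.
move=> E; apply: (mulIf (alpha_neq l)); rewrite mulfVK //.
rewrite [RHS]mulrAC [X in _ = X / _]mulrC -E; ring.
Qed.

Definition seed_step sd e : R := if sd.1 then e / (1 + e) else e.

(** The [m]-th derivative of [q] at 0. Its transform of length [s] with step [x / s] tends to [q(x)]
    as [s] grows. *)
Definition exp_coef (q : {poly R}) m : R := m`!%:R * q`_m.

Lemma bintr_node_val sd e s l : 1 + e != 0 ->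
  bintr e (node_val sd) s l = (if sd.1 then (1 + e) ^+ s else 1) * seed_norm sd *
    bintr (seed_step sd e) (exp_coef (seed_row alpha sd l)) s 0.
Proof.
move=> e1; have := node_val_coef sd; rewrite /seed_step.
case: sd => [[]] f /= val; last first.
  by rewrite mul1r -bintrZ; apply: eq_bigr => j _; rewrite val add0n.
pose h m i := exp_coef (seed_row alpha (true, f) m) i.
have hS m i : h m i.+1 = h m.+1 i - h m i.
  have := congr1 (fun p : {poly R} => p`_i) (deriv_seed_row alpha (true, f) m).
  rewrite coef_deriv coefB scale1r -mulr_natr /h /exp_coef => E.
  by rewrite -mulrBr -E factS natrM; ring.
have := bintr_euler s l e1 hS; rewrite mulrAC => <-; rewrite mulrC -bintrZ.
by apply: eq_bintr => m; rewrite (val m 0%N).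
Qed.

Definition wronskian k (sg : nat -> bool * nat) : {poly R} :=
  \det (\matrix_(i < k, j < k) seed_row alpha (sg i) j).

Section Admissible.
Variables (k : nat) (sg : nat -> bool * nat) (kap : R) (p : nat).
Hypothesis node_inj : {in [pred i | (i < k)%N] &, injective (seed_node alpha \o sg)}.
Hypothesis kap_tail : forall n, (p <= n)%N -> 0 < kap * pochhammer c n.
Hypothesis adm : forall n : nat,
  0 <= kap * pochhammer c n * (root_poly (seed_node alpha \o sg) k).[n%:R].

(** Taken as a polynomial in the step [e], so that the intermediate value theorem applies down to
    [e = 0]. *)
Definition bintr_det s : {poly R} :=
  \det (\matrix_(i < k, j < k) bintr 'X (fun m => (node_val (sg i) m)%:P) s j).

Lemma horner_bintr_det s e :
  (bintr_det s).[e] = \det (\matrix_(i < k, j < k) bintr e (node_val (sg i)) s j).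
Proof.
rewrite horner_det; congr (\det _); apply/matrixP => i j; rewrite !mxE.
by rewrite horner_bintr hornerX; apply: eq_bintr => m; rewrite hornerC.
Qed.

Lemma bintr_det_neq0 s e : 0 < e -> (bintr_det s).[e] != 0.
Proof.
move=> e0; rewrite horner_bintr_det.
have := det_bintr_neq0 alpha_neq kap_tail node_inj adm s e0.
congr (_ != _); congr (\det _); apply/matrixP => i j; rewrite !mxE.
by rewrite horner_bintr hornerC.
Qed.

Definition node_det : R := \det (\matrix_(i < k, j < k) node_val (sg i) j).

Lemma node_det_neq0 : node_det != 0.
Proof.
have := bintr_det_neq0 0 ltr01; rewrite horner_bintr_det.
by congr (_ != _); congr (\det _); apply/matrixP => i j; rewrite !mxE bintr0.
Qed.

Lemma bintr_det_sign s e : 0 < e -> 0 < node_det * (bintr_det s).[e].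
Proof.
move=> e0; rewrite ltNge; apply/negP.
have <- : (bintr_det s).[0] = node_det.
  rewrite horner_bintr_det; congr (\det _); apply/matrixP => i j.
  by rewrite !mxE bintr_at0.
move=> /(polyrcf.poly_ivt (ltW e0)) [y /andP[y0 _] /rootP Ey].
have [y00|y00] := eqVneq y 0.
  have := node_det_neq0; rewrite /node_det.
  move: Ey; rewrite y00 horner_bintr_det.
  under eq_mx do rewrite bintr_at0.
  by move=> ->; rewrite eqxx.
have y1 : 0 < y by rewrite lt_def y00.
by have := bintr_det_neq0 s y1; rewrite Ey eqxx.
Qed.

Definition seed_norms : R := \prod_(i < k) seed_norm (sg i).

Lemma node_det_wronskian0 : node_det = seed_norms * (wronskian k sg).[0].
Proof.
rewrite /wronskian horner_det -det_scale_rows; congr (\det _).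
apply/matrixP => i j; rewrite !mxE -(bintr0 0 (node_val (sg i))) bintr_node_val ?addr0 ?oner_eq0 //.
by rewrite bintr0 /exp_coef mul1r horner_coef0 expr0; case: (sg i).1; rewrite mul1r.
Qed.

(* A polynomial in [t = 1/s] whose value at [0] is that of [seed_row] at [x]. *)
Definition limit_entry x sd l : {poly R} := \sum_(j < sd.2.+1)
  (\prod_(h < j) (1 - h%:R *: 'X)) * (x ^+ j * (seed_row alpha sd l)`_j)%:P *
  (if sd.1 then (1 + x *: 'X) ^+ (sd.2 - j) else 1).

Lemma limit_entry0 x sd l : (limit_entry x sd l).[0] = (seed_row alpha sd l).[x].
Proof.
rewrite (horner_coef_wide _ (size_seed_row alpha sd l)) horner_sum.
apply: eq_bigr => j _; rewrite !hornerM horner_prod hornerC big1 ?mul1r.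
  rewrite [x ^+ j * _]mulrC; case: (sd.1); last by rewrite hornerC mulr1.
  by rewrite horner_exp !hornerE ?mulr0 ?addr0 expr1n mulr1.
by move=> i _; rewrite !hornerE ?mulr0 ?subr0.
Qed.

Lemma natr_ffact (s j : nat) : (s ^_ j)%:R = \prod_(h < j) (s%:R - h%:R) :> R.
Proof.
elim: j => [|j IH]; first by rewrite big_ord0 ffactn0.
rewrite ffactnSr natrM big_ord_recr /= -IH.
have [js|sj] := leqP j s; first by rewrite natrB.
by rewrite ffact_small // !mul0r.
Qed.

(** A positive factor that clears the denominators of the step [e / (1 + e)]. *)
Definition seed_weight sd x : R := if sd.1 then (1 + x) ^+ sd.2 else 1.

Lemma limit_entryE x sd l s : 0 <= x -> (0 < s)%N ->
  (limit_entry x sd l).[s%:R^-1] = seed_weight sd (x / s%:R) *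
    bintr (seed_step sd (x / s%:R)) (exp_coef (seed_row alpha sd l)) s 0.
Proof.
move=> x0 s0; have s0' : s%:R != 0 :> R by rewrite pnatr_eq0 -lt0n.
have e1 : 1 + x / s%:R != 0 by rewrite gt_eqF // ltr_wpDr // divr_ge0.
rewrite (@bintr_trunc _ _ _ s sd.2.+1); last first.
  by move=> m fm; rewrite /exp_coef nth_default ?mulr0 // (leq_trans (size_seed_row _ _ _)).
rewrite horner_sum mulr_sumr; apply: eq_bigr => j _; rewrite !hornerM horner_prod hornerC.
have -> : \prod_(h < j) (1 - h%:R *: 'X).[s%:R^-1] = 'C(s, j)%:R * j`!%:R / s%:R ^+ j :> R.
  rewrite -natrM bin_ffact natr_ffact -exprVn.
  have -> : s%:R^-1 ^+ j = \prod_(h < j) s%:R^-1 :> R by rewrite prodr_const card_ord.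
  rewrite -big_split /=; apply: eq_bigr => h _.
  by rewrite !hornerE mulrBl divff.
rewrite /exp_coef /seed_weight /seed_step.
case: (sd.1); last first.
  by rewrite hornerC mulr1 mul1r expr_div_n; ring.
have -> : (1 + x / s%:R) ^+ sd.2 = (1 + x / s%:R) ^+ (sd.2 - j) * (1 + x / s%:R) ^+ j.
  by rewrite -exprD subnK // -ltnS.
rewrite horner_exp hornerD hornerZ hornerX hornerC !expr_div_n.
have : (1 + x / s%:R) ^+ j != 0 by rewrite expf_neq0.
move: (_ ^+ j) ((1 + x / s%:R) ^+ (sd.2 - j)) => u v u0; field.
by rewrite u0 expf_neq0.
Qed.

Lemma wronskian0_neq0 : (wronskian k sg).[0] != 0.
Proof.
by have := node_det_neq0; rewrite node_det_wronskian0 mulf_eq0 => /norP[].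
Qed.

Lemma wronskian_ge0 x : 0 <= x -> 0 <= (wronskian k sg).[0] * (wronskian k sg).[x].
Proof.
rewrite le_eqVlt => /predU1P[<-|x0]; first by rewrite -expr2 sqr_ge0.
pose H := \det (\matrix_(i < k, j < k) limit_entry x (sg i) j).
have H0 : H.[0] = (wronskian k sg).[x].
  rewrite /H /wronskian !horner_det; congr (\det _).
  by apply/matrixP => i j; rewrite !mxE limit_entry0.
(* Up to [seed_norms] and positive row factors, [H] at [1/s] is the Meixner determinant at
   [e = x/s]. *)
have Hs s : (0 < s)%N -> 0 < node_det * seed_norms * H.[s%:R^-1].
  move=> s0; have e0 : 0 < x / s%:R by rewrite divr_gt0 ?ltr0n.
  have e1 : 0 < 1 + x / s%:R by rewrite addr_gt0.
  have := bintr_det_sign s e0.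
  have -> : (bintr_det s).[x / s%:R] = seed_norms *
      ((\prod_(i < k) (if (sg i).1 then (1 + x / s%:R) ^+ s else 1)) *
      \det (\matrix_(i < k, j < k) bintr (seed_step (sg i) (x / s%:R))
        (exp_coef (seed_row alpha (sg i) j)) s 0)).
    rewrite mulrA -big_split horner_bintr_det -det_scale_rows; congr (\det _).
    apply/matrixP => i j; rewrite !mxE bintr_node_val ?gt_eqF //.
    by rewrite /= [X in X * _]mulrC.
  have -> : H.[s%:R^-1] = (\prod_(i < k) seed_weight (sg i) (x / s%:R)) *
      \det (\matrix_(i < k, j < k) bintr (seed_step (sg i) (x / s%:R))
        (exp_coef (seed_row alpha (sg i) j)) s 0).
    rewrite horner_det -det_scale_rows; congr (\det _).
    by apply/matrixP => i j; rewrite !mxE limit_entryE // ltW.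
  have : 0 < \prod_(i < k) (if (sg i).1 then (1 + x / s%:R) ^+ s else 1).
    by apply: prodr_gt0 => i _; case: ifP => // _; rewrite exprn_gt0.
  have : 0 < \prod_(i < k) seed_weight (sg i) (x / s%:R).
    by apply: prodr_gt0 => i _; rewrite /seed_weight; case: ifP => // _; rewrite exprn_gt0.
  move: (\prod_i _) (\prod_i _) (\det _) => B A D A0 B0.
  rewrite [X in 0 < X -> _](_ : _ = B * (node_det * seed_norms * D)); last by ring.
  by move=> D0; rewrite (mulrCA _ A) pmulr_rgt0 // -(pmulr_rgt0 _ B0).
(* The sign of [seed_norms] is unknown; it cancels since [node_det] contains the same factor. *)
have K0 : 0 < seed_norms ^+ 2.
  by rewrite exprn_even_gt0 //= prodf_seq_neq0; apply/allP => i _; exact: seed_norm_neq0.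
rewrite -(pmulr_rge0 _ K0) -H0 leNgt; apply/negP.
have -> : seed_norms ^+ 2 * ((wronskian k sg).[0] * H.[0]) = node_det * seed_norms * H.[0].
  by rewrite node_det_wronskian0; ring.
set G := (node_det * seed_norms) *: H.
rewrite -hornerZ -/G => G0.
have [|d d0 dG] := @poly_cont _ 0 G (- G.[0]); first by rewrite oppr_gt0.
pose s := (Num.truncn d^-1).+1.
have s0 : 0 < s%:R^-1 :> R by rewrite invr_gt0 ltr0n.
have : `|G.[s%:R^-1] - G.[0]| < - G.[0].
  apply: dG; rewrite subr0 gtr0_norm //.
  by rewrite -[d]invrK ltf_pV2 ?posrE ?invr_gt0 ?ltr0n // truncnS_gt.
rewrite ltr_norml => /andP[_]; rewrite ltrBlDr addNr hornerZ ltNge.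
by rewrite ltW // Hs.
Qed.

End Admissible.
End WeakSign.

(** * Bordered determinants *)

Lemma deriv_prod (K : comNzRingType) n (F : 'I_n -> {poly K}) :
  (\prod_i F i)^`() = \sum_i \prod_h (if h == i then (F h)^`() else F h).
Proof.
elim: n F => [|n IH] F; first by rewrite !big_ord0 derivC.
rewrite big_ord_recl derivM IH big_ord_recl big_ord_recl eqxx; congr (_ * _ + _).
rewrite mulr_sumr; apply: eq_bigr => i _; rewrite big_ord_recl /=.
by congr (_ * _); apply: eq_bigr => h _; rewrite (inj_eq lift_inj).
Qed.

Section DerivDet.
Variables (K : comNzRingType) (n : nat) (M : 'M[{poly K}]_n).

Lemma deriv_det :
  (\det M)^`() = \sum_i \sum_j (M i j)^`() * cofactor M i j.
Proof.
transitivity (\sum_i \det (\matrix_(h, j) (if h == i then (M h j)^`() else M h j))).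
  rewrite /determinant raddf_sum /= exchange_big; apply: eq_bigr => s _.
  rewrite -mulr_sumr.
  transitivity ((-1) ^+ odd_perm s * (\prod_i M i (s i))^`()); last first.
    rewrite deriv_prod; congr (_ * _); apply: eq_bigr => i _.
    by apply: eq_bigr => h _; rewrite mxE.
  have -> : (-1) ^+ odd_perm s = ((-1) ^+ odd_perm s)%:P :> {poly K} by rewrite polyC_exp polyCN.
  by rewrite derivM derivC mul0r add0r.
apply: eq_bigr => i _; rewrite (expand_det_row _ i); apply: eq_bigr => j _.
rewrite mxE eqxx; congr (_ * _); rewrite /cofactor; congr (_ * \det _).
by apply/matrixP => h l; rewrite !mxE eq_sym (negPf (neq_lift _ _)).
Qed.

End DerivDet.

Section BorderedDet.
Variable K : comNzRingType.
Implicit Types (A : nat -> nat -> K) (k l : nat).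

Definition det_of A k : K := \det (\matrix_(i < k, j < k) A i j).

(** For [l <= k], the cofactor at [(k, l)] of the matrix of size [k.+1]; it involves only the rows
    before [k]. *)
Definition bcof A k l : K := (-1) ^+ (k + l) * \det (\matrix_(i < k, j < k) A i (bump l j)).

Lemma det_bordered A k : det_of A k.+1 = \sum_(l < k.+1) A k l * bcof A k l.
Proof.
rewrite /det_of (expand_det_row _ ord_max); apply: eq_bigr => l _.
rewrite mxE /=; congr (_ * _); rewrite /cofactor /bcof; congr (_ * \det _).
by apply/matrixP => i j; rewrite !mxE /= /bump leqNgt ltn_ord.
Qed.

Lemma bcof_ge A k l : (k <= l)%N -> bcof A k l = (-1) ^+ (k + l) * det_of A k.
Proof.
move=> kl; rewrite /bcof; congr (_ * \det _); apply/matrixP => i j; rewrite !mxE.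
by rewrite /bump leqNgt (leq_trans (ltn_ord j) kl).
Qed.

Lemma bcof_diag A k : bcof A k k = det_of A k.
Proof. by rewrite bcof_ge // addnn -signr_odd odd_double mul1r. Qed.

(** The expansion of a determinant whose last row repeats row [i]. *)
Lemma bcof_kernel A k i : (i < k)%N -> \sum_(l < k.+1) A i l * bcof A k l = 0.
Proof.
move=> ik; pose A' h := if h == k then A i else A h.
transitivity (det_of A' k.+1).
  rewrite det_bordered; apply: eq_bigr => l _; rewrite /A' eqxx; congr (_ * _).
  rewrite /bcof; congr (_ * \det _); apply/matrixP => h j; rewrite !mxE.
  by rewrite ltn_eqF.
have ik' : (i < k.+1)%N by rewrite ltnW.
apply: (@determinant_alternate _ _ _ (Ordinal ik') ord_max).
  by rewrite -val_eqE /= ltn_eqF.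
by move=> j; rewrite !mxE /A' /= eqxx ltn_eqF.
Qed.

End BorderedDet.

(** Replacing column [j] by column [j.+1] repeats a column unless [j] is the last one; the surviving
    minor is [bcof A k.+1 k] up to sign. *)
Lemma deriv_det_of (K : comNzRingType) (A : nat -> nat -> {poly K}) (d : nat -> K) k :
  (forall i j, (A i j)^`() = A i j.+1 - d i *: A i j) ->
  (det_of A k.+1)^`() = - bcof A k.+1 k - (\sum_(i < k.+1) d i) *: det_of A k.+1.
Proof.
move=> dA; rewrite deriv_det; set M := (\matrix_(i, j) A i j).
under eq_bigr => i _.
  under eq_bigr => j _ do rewrite !mxE dA mulrBl.
  rewrite sumrB; over.
rewrite sumrB; congr (_ - _); last first.
  rewrite scaler_suml; apply: eq_bigr => i _; rewrite /det_of -/M (expand_det_row M i) scaler_sumr.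
  by apply: eq_bigr => j _; rewrite mxE scalerAl.
rewrite exchange_big big_ord_recr /= big1 ?add0r.
  rewrite /bcof addSn addnn exprS -signr_odd odd_double mulr1 mulN1r opprK.
  rewrite (expand_det_col _ ord_max); apply: eq_bigr => i _.
  rewrite mxE /= /bump leqnn add1n; congr (_ * _); rewrite /cofactor; congr (_ * \det _).
  apply/matrixP => h l; rewrite !mxE /= /bump [(k <= l)%N]leqNgt ltn_ord /=.
  by rewrite add0n [(k <= l)%N]leqNgt ltn_ord.
move=> j _; have jk : (j.+1 < k.+1)%N by rewrite ltnS.
have := congr1 (fun N : 'M_k.+1 => N (widen_ord (leqnSn k) j) (Ordinal jk)) (mul_adj_mx M).
rewrite !mxE -val_eqE /= ltn_eqF // mulr0n => E; rewrite -[RHS]E.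
by apply: eq_bigr => i _; rewrite !mxE mulrC.
Qed.

(** * Multiplicity of roots and changes of sign *)

Section PolyMultiplicity.
Variable R : realType.
Implicit Types (p q : {poly R}) (x : R).

(** In characteristic zero, differentiation lowers the multiplicity of a root by exactly one. *)
Lemma dvdp_exp_deriv p x m : ('X - x%:P) ^+ m %| p^`() -> p.[x] = 0 ->
  ('X - x%:P) ^+ m.+1 %| p.
Proof.
move=> dp px; have [->|p0] := eqVneq p 0; first exact: dvdp0.
have [j [q qx pE]] := multiplicity_XsubC p x.
move: qx; rewrite p0 /= => qx.
have [mj|jm] := ltnP m j.
  by rewrite pE; apply: dvdp_mull; exact: dvdp_exp2l.
case: j => [|j] in pE jm *.
  by move: px qx; rewrite pE expr0 mulr1 /root => ->; rewrite eqxx.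
have : ('X - x%:P) ^+ j.+1 %| p^`() by apply: dvdp_trans dp; exact: dvdp_exp2l.
rewrite pE derivM deriv_exp derivXsubC mul1r exprS => H.
have {H} : ('X - x%:P) * ('X - x%:P) ^+ j %| (q *+ j.+1) * ('X - x%:P) ^+ j.
  have <- : q^`() * (('X - x%:P) * ('X - x%:P) ^+ j) +
    q * (('X - x%:P) ^+ j *+ j.+1) - q^`() * (('X - x%:P) * ('X - x%:P) ^+ j) =
    (q *+ j.+1) * ('X - x%:P) ^+ j.
    by rewrite addrAC subrr add0r mulrnAr mulrnAl.
  by apply: dvdp_sub => //; exact: dvdp_mulIr.
rewrite dvdp_mul2r ?expf_neq0 ?polyXsubC_eq0 // dvdp_XsubCl /root hornerMn.
by rewrite mulrn_eq0 /= => qx'; move: qx; rewrite /root qx'.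
Qed.

Lemma simple_root_sign p x : 0 < x -> p.[x] = 0 ->
  (forall y, 0 <= y -> 0 <= p.[y]) -> p^`().[x] = 0.
Proof.
move=> x0 px p_ge0; have /factor_theorem[q pE] : root p x by apply/rootP.
have -> : p^`().[x] = q.[x].
  by rewrite pE derivM derivXsubC mulr1 hornerD hornerM hornerXsubC subrr mulr0 add0r.
apply/eqP/negPn/negP => qx.
have [|d d0 dq] := @poly_cont _ x q `|q.[x]|; first by rewrite normr_gt0.
(* Keeps [x - y] nonnegative and both [x - y] and [x + y] in the range where [q] has the sign of
   [q.[x]]. *)
pose y := Num.min d x / 2.
have m0 : 0 < Num.min d x by rewrite lt_min d0.
have md : Num.min d x <= d by rewrite ge_min lexx.
have mx : Num.min d x <= x by rewrite ge_min lexx orbT.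
have [y0 [yd yx]] : 0 < y /\ y < d /\ y <= x by rewrite /y; split; [|split]; lra.
have H1 := dq (x + y); have H2 := dq (x - y).
rewrite [x + y]addrC addrK gtr0_norm // in H1.
rewrite [x - y]addrC addrK normrN gtr0_norm // in H2.
have := p_ge0 (x - y); have := p_ge0 (x + y).
rewrite pE !hornerM !hornerXsubC !subr_ge0 [x + y]addrC [x - y]addrC !addrK.
rewrite mulrN oppr_ge0 pmulr_lle0 // pmulr_lge0 // => G1 G2.
have {}G1 := G1 (addr_ge0 (ltW y0) (ltW x0)).
have {}G2 := G2 yx.
move: (H1 yd) (H2 yd).
have [q0|q0|q0] := ltrgt0P q.[x]; last by rewrite q0 eqxx in qx.
  by rewrite !ltr_norml => _ /andP[]; lra.
by rewrite !ltr_norml => /andP[_]; lra.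
Qed.

End PolyMultiplicity.

(** * Kernel vectors of a bordered matrix *)

Section BorderKernel.
Variables (R : fieldType) (E : nat -> nat -> R) (nu z : nat -> R) (x c : R) (N : nat).
Hypothesis x_neq0 : x != 0.
Hypothesis ode : forall i j,
  x * E i j.+2 + (c + j%:R - x) * E i j.+1 + (nu i - j%:R) * E i j = 0.
Hypothesis z_ge : forall l, (N <= l)%N -> z l = 0.
Hypothesis z_kernel : forall i, (i <= N)%N -> \sum_(l < N.+2) E i l * z l = 0.
Hypothesis det_neq0 : det_of E N.+2 != 0.

Let shift (y : nat -> R) l : R := if l is l'.+1 then y l' else 0.

Let sum_shift (F y : nat -> R) n :
  \sum_(l < n.+1) F l * shift y l = \sum_(l < n) F l.+1 * y l.
Proof.
by rewrite big_ord_recl /= mulr0 add0r; apply: eq_bigr.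
Qed.

(* The differential equation turns the kernel vector [z] into another one,
   which has to be [- nu N.+1] times [z] as the bordered matrix is invertible;
   their difference [v] then has leading entry [x] times that of [z]. *)
Let v l : R := x * shift (shift z) l + shift (fun j => (c + j%:R - x) * z j) l +
  (nu N.+1 - l%:R) * z l.

(** By [ode] the sum reduces to [nu N.+1 - nu i] times the pairing of row [i] with [z]: the pairing
    vanishes for [i <= N], the factor for [i = N.+1]. *)
Let sum_v i : (i < N.+2)%N -> \sum_(l < N.+2) E i l * v l = 0.
Proof.
move=> iN; rewrite /v.
transitivity (x * (\sum_(l < N.+2) E i l * shift (shift z) l) +
   \sum_(l < N.+2) E i l * shift (fun j => (c + j%:R - x) * z j) l +
   \sum_(l < N.+2) (nu N.+1 - l%:R) * (E i l * z l)).
  by rewrite mulr_sumr -!big_split; apply: eq_bigr => l _ /=; ring.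
rewrite !sum_shift (sum_shift (fun l => E i l.+1)) !big_ord_recr /= !z_ge //.
rewrite !mulr0 !addr0 mulr_sumr -!big_split /=.
transitivity ((nu N.+1 - nu i) * \sum_(l < N.+2) E i l * z l); last first.
  move: iN; rewrite ltnS leq_eqVlt => /predU1P[->|iN]; first by rewrite subrr mul0r.
  by rewrite z_kernel // mulr0.
rewrite !big_ord_recr /= !z_ge // !mulr0 !addr0 mulr_sumr; apply: eq_bigr => l _.
transitivity ((x * E i l.+2 + (c + l%:R - x) * E i l.+1 + (nu i - l%:R) * E i l) * z l +
  (nu N.+1 - nu i) * (E i l * z l)); first by ring.
by rewrite ode mul0r add0r.
Qed.

(** As [v] vanishes, its entry at [l.+2] expresses [x z_l] through [z_(l+1)] and [z_(l+2)]; descend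
    from [N]. *)
Lemma border_kernel_eq0 l : z l = 0.
Proof.
have v0 n : (n < N.+2)%N -> v n = 0.
  move=> nN; pose A := \matrix_(i < N.+2, j < N.+2) E i j.
  pose u := \col_(j < N.+2) v j.
  have Au : A *m u = 0.
    apply/matrixP => i j; rewrite !mxE -[RHS](sum_v (ltn_ord i)).
    by apply: eq_bigr => h _; rewrite !mxE.
  have Aunit : A \in unitmx by rewrite unitmxE unitfE.
  have := mulKmx Aunit u; rewrite Au mulmx0 => /matrixP /(_ (Ordinal nN) 0).
  by rewrite !mxE.
suff H d : forall l, (N <= l + d)%N -> z l = 0 by apply: (H N); exact: leq_addl.
elim: d => [|d IH] {}l lN; first by rewrite z_ge // -[l]addn0.
have [Nl|lN'] := leqP N l; first exact: z_ge.
have := v0 l.+2; rewrite /v /= !ltnS => /(_ lN').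
rewrite (IH l.+1) ?(IH l.+2) ?addSn -?addnS // ?mulr0 ?addr0; last first.
  by rewrite !addnS; rewrite addnS in lN; rewrite (leq_trans lN) // ltnW.
by move/eqP; rewrite mulf_eq0 (negPf x_neq0) => /eqP.
Qed.

End BorderKernel.

(** * Absence of positive zeros *)

Section Strictness.
Variables (R : realType) (alpha : R).
Hypothesis alpha_neq : forall n, alpha + 1 + n%:R != 0.
Local Notation c := (alpha + 1).
Local Notation row := (seed_row alpha).
Implicit Types (x : R) (sg : nat -> bool * nat).

Lemma seed_node_inj : injective (seed_node alpha).
Proof.
have nf n f : n%:R != - c - f%:R.
  apply: contra_neq (alpha_neq (n + f)) => E; rewrite natrD E; ring.
move=> [[] f] [[] g]; rewrite /seed_node /= => E.
- by move/addrI/oppr_inj/eqP: E; rewrite eqr_nat => /eqP ->.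
- by move: (nf g f); rewrite E eqxx.
- by move: (nf f g); rewrite E eqxx.
- by move/eqP: E; rewrite eqr_nat => /eqP ->.
Qed.

(* The three-term recurrence in [f] acts on the combination like multiplication
   by ['X], up to a term that lowers the index [l]. *)
Lemma seed_rows_dvdp x m n f0 (y : nat -> {poly R}) :
  (forall f, (f0 <= f)%N -> ('X - x%:P) ^+ m %| \sum_(l < n) row (true, f) l * y l) ->
  forall l, (l < n)%N -> ('X - x%:P) ^+ m %| y l.
Proof.
elim: n f0 y => [//|n IH] f0 y dS.
have dy l : (l < n)%N -> ('X - x%:P) ^+ m %| y l.+1.
  move=> ln; have := IH f0.+1 (fun l => l.+1%:R *: y l.+1).
  move=> /(_ _ l ln); rewrite dvdpZr ?pnatr_eq0 //; apply=> -[//|f] ff.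
  have <- : f.+2%:R *: (\sum_(l < n.+1) row (true, f.+2) l * y l)
      - (2 * f.+1%:R + 1 + alpha) *: (\sum_(l < n.+1) row (true, f.+1) l * y l)
      + (f.+1%:R + alpha) *: (\sum_(l < n.+1) row (true, f) l * y l)
      - 'X * (\sum_(l < n.+1) row (true, f.+1) l * y l) =
    \sum_(l < n) row (true, f.+1) l * (l.+1%:R *: y l.+1).
    rewrite mulr_sumr !scaler_sumr -sumrB -big_split -sumrB /=.
    transitivity (\sum_(l < n.+1) (l%:R *: row (true, f.+1) l.-1) * y l).
      apply: eq_bigr => h _; have := seed_row_rec alpha f h.
      rewrite -!mul_polyC => E; transitivity
        (((f.+2%:R)%:P * row (true, f.+2) h - (2 * f.+1%:R + 1 + alpha)%:P * row (true, f.+1) h +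
        (f.+1%:R + alpha)%:P * row (true, f) h) * y h - 'X * row (true, f.+1) h * y h).
        by rewrite !mulrDl !mulNr !mulrA.
      by rewrite E; ring.
    rewrite big_ord_recl scale0r mul0r add0r; apply: eq_bigr => h _.
    by rewrite lift0 -scalerAl scalerAr.
  have f1 : (f0 <= f.+1)%N by exact: ltnW.
  do 3?[apply: dvdp_sub | apply: dvdp_add].
  - by rewrite dvdpZr ?pnatr_eq0 // dS // (leq_trans f1).
  - by rewrite -mul_polyC; apply: dvdp_mull; exact: dS.
  - by rewrite -mul_polyC; apply: dvdp_mull; exact: dS.
  - by apply: dvdp_mull; exact: dS.
case=> [_|l ln]; last exact: dy.
(* With the other [y l] divisible, only [y 0] remains, multiplied by a row entry prime to
   ['X - x]. *)
have [n'|f ff rx] := @seed_row_horner_neq0 _ alpha x f0.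
  by rewrite -nat1r addrA.
have := dS f ff; rewrite big_ord_recl dvdp_addl; last first.
  apply: (big_ind (fun q => _ %| q)); first exact: dvdp0.
    by move=> p q; exact: dvdp_add.
  by move=> h _; apply: dvdp_mull; exact: dy.
by rewrite Gauss_dvdpr // coprimep_expl // coprimep_sym coprimep_XsubC /root.
Qed.

Variables (kap : R) (p : nat).
Hypothesis kap_tail : forall n, (p <= n)%N -> 0 < kap * pochhammer c n.

Definition admissible_seeds k sg : Prop :=
  {in [pred i | (i < k)%N] &, injective sg} /\
  forall n : nat, 0 <= kap * pochhammer c n *
    (root_poly (seed_node alpha \o sg) k).[n%:R].

Definition extend k sg f i : bool * nat := if (i < k)%N then sg i else (true, f).

(** For [f] larger than [|c|] the node [-c-f] is negative, so the new factor is positive at every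
    [n]; the sum of all degrees is a crude bound beyond which the seed is new. *)
Lemma extend_admissible k sg : admissible_seeds k sg ->
  exists f0, forall f, (f0 <= f)%N -> admissible_seeds k.+1 (extend k sg f).
Proof.
move=> [inj adm]; exists (maxn (Num.truncn `|c|) (\sum_(i < k) (sg i).2)%N).+1 => f.
rewrite gtn_max => /andP[cf sf]; split.
  have neq i : (i < k)%N -> sg i != (true, f).
    move=> ik; apply: contraTneq sf => E; rewrite -leqNgt.
    by rewrite (bigD1 (Ordinal ik)) //= E leq_addr.
  move=> i j; rewrite !inE !ltnS /extend => ik jk.
  case: ltnP => ik'; case: ltnP => jk' E.
  - exact: inj.
  - by move: (neq _ ik'); rewrite E eqxx.
  - by move: (neq _ jk'); rewrite -E eqxx.
  - by apply/eqP; rewrite eqn_leq (leq_trans ik jk') (leq_trans jk ik').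
move=> n; rewrite /root_poly big_ord_recr /= hornerM mulrA mulr_ge0 //.
  have := adm n; rewrite /root_poly; congr (0 <= _ * _.[_]).
  by apply: eq_bigr => i _; rewrite /extend /= ltn_ord.
rewrite hornerXsubC /extend ltnn /seed_node /= -opprD opprK.
have : `|c| < f%:R.
  by apply: lt_le_trans (truncnS_gt _) _; rewrite ler_nat.
rewrite ltr_norml => /andP[cl _].
by rewrite addr_ge0 // -lerBlDr sub0r ltW.
Qed.

Let rows sg i j := row (sg i) j.

Lemma wronskian_deriv k sg : exists t, (wronskian alpha k.+1 sg)^`() =
  - bcof (rows sg) k.+1 k - t *: wronskian alpha k.+1 sg.
Proof.
exists (\sum_(i < k.+1) (sg i).1%:R).
apply: (@deriv_det_of _ (rows sg) (fun i => (sg i).1%:R)) => i j.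
exact: deriv_seed_row.
Qed.

Lemma wronskian_extend k sg f : wronskian alpha k.+1 (extend k sg f) =
  \sum_(l < k.+1) row (true, f) l * bcof (rows sg) k l.
Proof.
rewrite -[LHS]/(det_of (rows (extend k sg f)) k.+1) det_bordered.
apply: eq_bigr => l _; rewrite /rows /extend ltnn; congr (_ * _).
rewrite /bcof; congr (_ * \det _); apply/matrixP => i j; rewrite !mxE.
by rewrite ltn_ord.
Qed.

(** If this cofactor vanished too, the cofactors at [x] would form a kernel vector vanishing from
    index [k] on, hence zero by [border_kernel_eq0], and so would be the extended Wronskian. *)
Lemma wronskian_extend_simple k sg f x : 0 < x ->
  (wronskian alpha k.+1 sg).[x] = 0 ->
  (wronskian alpha k.+2 (extend k.+1 sg f)).[x] != 0 ->
  (bcof (rows sg) k.+1 k).[x] != 0.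
Proof.
move=> x0 Wx; apply: contra_neq => bx.
pose E i j := (rows (extend k.+1 sg f) i j).[x].
have WE l sg' : (wronskian alpha l sg').[x] = det_of (fun i j => (rows sg' i j).[x]) l.
  exact: horner_det.
apply/eqP/negPn/negP; rewrite WE => dE.
pose z l := (bcof (rows sg) k.+1 l).[x].
have ext i l : (i <= k)%N -> rows (extend k.+1 sg f) i l = rows sg i l.
  by move=> ik; rewrite /rows /extend ltnS ik.
have z0 : forall l, z l = 0.
  apply: (@border_kernel_eq0 R E (fun i => seed_node alpha (extend k.+1 sg f i)) z x c k) => //.
  - by rewrite gt_eqF.
  - move=> i j; have := congr1 (horner^~ x) (seed_row_ode alpha (extend k.+1 sg f i) j).
    by rewrite horner0 !hornerE.
  - move=> l; rewrite leq_eqVlt => /predU1P[<-//|kl].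
    by rewrite /z bcof_ge // hornerM -[det_of _ _]/(wronskian alpha k.+1 sg) Wx mulr0.
  - move=> i ik; have := congr1 (horner^~ x) (@bcof_kernel _ (rows sg) k.+1 i ik).
    rewrite horner0 horner_sum => Z; rewrite -[RHS]Z.
    by apply: eq_bigr => l _; rewrite hornerM /E ext.
move: dE; rewrite -WE wronskian_extend horner_sum big1 ?eqxx // => l _.
by rewrite hornerM -[X in _ * X]/(z l) z0 mulr0.
Qed.

(* Adding a seed [(true, f)] to a Wronskian with a zero at [x] may be done so as
   to lower the multiplicity of [x]; by induction the larger Wronskian does not
   vanish at [x], and then [x] is a simple zero of the smaller one, which
   contradicts its constant sign. *)
Lemma wronskian_neq0_of_ndvd m k sg x : 0 < x -> admissible_seeds k sg ->
  ~~ (('X - x%:P) ^+ m %| wronskian alpha k sg) -> (wronskian alpha k sg).[x] != 0.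
Proof.
move=> x0; elim: m k sg => [|m IH] [|k] sg adm; rewrite ?dvd1p //.
  by move=> _; rewrite /wronskian det_mx00 hornerC oner_eq0.
apply: contraNneq => Wx.
have [f0 ext_adm] := extend_admissible adm.
have [t Wd] := wronskian_deriv k sg.
(* If all these extensions are divisible, so are all cofactors, hence the Wronskian and its
   derivative, and the exponent rises by one. *)
suff dW f : (f0 <= f)%N -> ('X - x%:P) ^+ m %| wronskian alpha k.+2 (extend k.+1 sg f).
  have db : forall l, (l < k.+2)%N -> ('X - x%:P) ^+ m %| bcof (rows sg) k.+1 l.
    by apply: (@seed_rows_dvdp x m k.+2 f0) => f /dW; rewrite wronskian_extend.
  apply: dvdp_exp_deriv => //; rewrite Wd; apply: dvdp_sub.
    by rewrite dvdpNr db.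
  rewrite -mul_polyC; apply: dvdp_mull; have := db k.+1 (leqnn _).
  by rewrite bcof_diag.
move=> ff; apply/negPn/negP => /(IH _ _ (ext_adm f ff)) /(wronskian_extend_simple x0 Wx).
move=> /negP; apply; case: adm => inj sgn.
have node_inj : {in [pred i | (i < k.+1)%N] &, injective (seed_node alpha \o sg)}.
  by move=> i j ik jk /seed_node_inj; exact: inj.
pose W := wronskian alpha k.+1 sg.
have W0 : W.[0] != 0 by apply: (wronskian0_neq0 alpha_neq node_inj kap_tail sgn).
have : (W.[0] *: W)^`().[x] = 0.
  apply: simple_root_sign => // [|y y0]; rewrite hornerZ ?Wx ?mulr0 //.
  exact: (wronskian_ge0 alpha_neq node_inj kap_tail sgn).
rewrite derivZ hornerZ => /eqP.
rewrite mulf_eq0 (negPf W0) /= Wd hornerD !hornerN hornerZ Wx mulr0 subr0.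
by rewrite oppr_eq0.
Qed.

Theorem wronskian_neq0 k sg x : admissible_seeds k sg -> 0 <= x ->
  (wronskian alpha k sg).[x] != 0.
Proof.
move=> adm; have [inj sgn] := adm.
have node_inj : {in [pred i | (i < k)%N] &, injective (seed_node alpha \o sg)}.
  by move=> i j ik jk /seed_node_inj; exact: inj.
have W0 := wronskian0_neq0 alpha_neq node_inj kap_tail sgn.
rewrite le_eqVlt => /predU1P[<-//|x0].
(* This exponent exceeds the degree of the Wronskian, which is nonzero because of its value at 0. *)
apply: (@wronskian_neq0_of_ndvd (size (wronskian alpha k sg))) => //.
apply/negP => /dvdp_leq.
rewrite size_exp_XsubC ltnn => /(_ _)/negP; apply; rewrite // -lead_coef_eq0.
by apply: contra_neq W0 => /eqP; rewrite lead_coef_eq0 => /eqP ->; rewrite horner0.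
Qed.

End Strictness.

(** * Admissible pairs *)

Section Admissibility.
Variables (R : realType) (c : R).
Hypothesis c_neq : forall n, c + n%:R != 0.
Implicit Types (n p k : nat).

Lemma pochhammerD n p : pochhammer c (n + p) = pochhammer c n * pochhammer (c + n%:R) p.
Proof.
elim: p => [|p IH]; first by rewrite addn0 pochhammer0 mulr1.
by rewrite addnS !pochhammerS IH natrD -mulrA addrA.
Qed.

Lemma pochhammer_gt0 (y : R) n : 0 < y -> 0 < pochhammer y n.
Proof. by move=> y0; apply: prodr_gt0 => i _; rewrite ltr_wpDr. Qed.

Lemma addr_chat_gt0 : 0 < c + (chat c)%:R.
Proof.
rewrite lt_def c_neq /= -lerBlDl sub0r /chat pmulrn gez0_abs ?le_max ?lexx ?orbT //.
apply: (@le_trans _ _ (- Num.floor c)%:~R); last by rewrite ler_int le_max lexx.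
by rewrite mulrNz lerN2 floor_le.
Qed.

Lemma addr_chat_lt1 : (0 < chat c)%N -> c + (chat c)%:R < 1.
Proof.
rewrite /chat pmulrn; have [fc|fc] := leP (- Num.floor c) 0; first by rewrite absz0.
by rewrite gtz0_abs // mulrNz ltrBlDr addrC -[1]/(1%:~R) -intrD floorD1_gt.
Qed.

(** From index [chat c] on, only positive factors are added, so [pochhammer c (chat c)] can serve as
    [kap]. *)
Lemma chat_tail n : (chat c <= n)%N -> 0 < pochhammer c (chat c) * pochhammer c n.
Proof.
move=> pn; rewrite -(subnKC pn) pochhammerD mulrA pmulr_lgt0.
  by rewrite -expr2 exprn_even_gt0 //= prodf_seq_neq0; apply/allP => i _ /=.
exact: pochhammer_gt0 addr_chat_gt0.
Qed.

(** Passes from the quotient in [admissible] to the Meixner weight, by [(c)_n (c + n)_p = (c)_(n+p)]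
    and the constant sign of [(c)_m] for [m >= p]. *)
Lemma chat_quotient_ge0 n (y : R) : 0 <= y / pochhammer (n%:R + c) (chat c) ->
  0 <= pochhammer c (chat c) * pochhammer c n * y.
Proof.
set p := chat c => y0.
have pc : pochhammer (n%:R + c) p != 0.
  by rewrite prodf_seq_neq0; apply/allP => i _ /=; rewrite (addrC n%:R) -addrA -natrD.
have -> : pochhammer c p * pochhammer c n * y =
    pochhammer c p * pochhammer c (n + p) * (y / pochhammer (n%:R + c) p).
  by rewrite pochhammerD (addrC c); field.
by rewrite mulr_ge0 // addnC ltW // chat_tail // leq_addr.
Qed.

(* If [k < p] then the alternating sum of [root_poly] at [0, ..., p] is a
   vanishing finite difference whose terms all have the same sign. *)
Lemma chat_le_size k (nu : nat -> R) :
  (forall n, 0 <= pochhammer c (chat c) * pochhammer c n * (root_poly nu k).[n%:R]) ->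
  (chat c <= k)%N.
Proof.
set p := chat c; set Q := root_poly nu k => adm; rewrite leqNgt; apply/negP => kp.
have sQ : size Q = k.+1 by exact: size_root_poly.
have poch0 n : pochhammer c n != 0 by rewrite prodf_seq_neq0; apply/allP => i _ /=.
(* Since [c + p < 1], the factors [c + j] with [j < p] are negative. *)
have poch_sign j : (j <= p)%N -> 0 < (-1) ^+ j * pochhammer c j.
  elim: j => [|j IH] jp; first by rewrite pochhammer0 mulr1.
  rewrite pochhammerS exprS mulrA -[_ * _ ^+ j * _]mulrA -mulrA mulrCA.
  rewrite pmulr_rgt0 ?IH 1?ltnW // mulN1r oppr_gt0.
  have := addr_chat_lt1 (leq_ltn_trans (leq0n k) kp); rewrite -/p.
  have : j.+1%:R <= p%:R :> R by rewrite ler_nat.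
  by rewrite -natr1; lra.
pose F j := pochhammer c p * ('C(p, j)%:R * (-1) ^+ j * Q.[j%:R]).
have F_ge0 j : (j <= p)%N -> 0 <= F j.
  move=> jp; have := poch_sign j jp; have := adm j.
  have uu : (-1) ^+ j * (-1) ^+ j = 1 :> R by rewrite -expr2 sqrr_sign.
  move: uu; rewrite -/p /F; move: ((-1) ^+ j) (pochhammer c j) (pochhammer c p) Q.[_].
  move=> s u v q ss uvq su; rewrite -(pmulr_rge0 _ su).
  rewrite [X in 0 <= X](_ : _ = (s * s) * ('C(p, j)%:R * (v * u * q))); last by ring.
  by rewrite ss mul1r mulr_ge0.
have sumF : \sum_(j < p.+1) F j = 0.
  rewrite -mulr_sumr; have := @bintr_horner0 _ Q p 0.
  by rewrite sQ /bintr => ->; rewrite ?mulr0.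
(* Nonnegative terms with zero sum all vanish; [p.+1] roots are too many for degree [k < p]. *)
have F0 j : (j < p.+1)%N -> Q.[j%:R] = 0.
  move=> jp; have := eqxx (0 : R); rewrite -[X in X == _]sumF.
  rewrite psumr_eq0; last by move=> i _; apply: F_ge0; rewrite -ltnS.
  move=> /allP /(_ (Ordinal jp)); rewrite mem_index_enum => /(_ isT) /= /eqP /eqP.
  rewrite /F !mulf_eq0 (negPf (poch0 _)) signr_eq0 pnatr_eq0 -[_ == 0]negbK -lt0n bin_gt0.
  by rewrite -ltnS jp /= => /eqP.
have := @max_poly_roots _ Q [seq j%:R | j <- iota 0 p.+1].
rewrite -size_poly_eq0 sQ size_map size_iota => /(_ isT).
have -> : all (root Q) [seq j%:R | j <- iota 0 p.+1].
  apply/allP => z /mapP[j]; rewrite mem_iota => jp ->; exact/rootP/F0.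
rewrite map_inj_uniq ?iota_uniq => [|i j /eqP]; last by rewrite eqr_nat => /eqP.
by move=> /(_ isT isT); rewrite ltnS ltnNge ltnW.
Qed.

End Admissibility.

(** * The pair of sets as a sequence of seeds *)

Section Seeds.
Variables (F1 F2 : {fset nat}).

Definition seeds i : bool * nat :=
  if (i < #|` F1|)%N then (false, fset_nth F1 i) else (true, fset_nth F2 (i - #|` F1|)).

Lemma fset_nth_inj (F : {fset nat}) : {in [pred i | (i < #|` F|)%N] &, injective (fset_nth F)}.
Proof.
move=> i j ik jk; rewrite /fset_nth => /eqP.
by rewrite nth_uniq ?size_sort ?sort_uniq ?fset_uniq // => /eqP.
Qed.

Lemma prod_fset_nth (R : comNzRingType) (F : {fset nat}) (h : nat -> R) :
  \prod_(i < #|` F|) h (fset_nth F i) = \prod_(f <- F) h f.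
Proof.
rewrite [RHS](perm_big (sort leq F)) /=; last by rewrite perm_sym perm_sort.
by rewrite (big_nth 0%N) size_sort big_mkord.
Qed.

Lemma seeds_inj : {in [pred i | (i < #|` F1| + #|` F2|)%N] &, injective seeds}.
Proof.
move=> i j; rewrite !inE /seeds => ik jk.
case: ltnP => i1; case: ltnP => j1 //= [].
  exact: fset_nth_inj.
move=> /fset_nth_inj; rewrite !inE !ltn_subLR // => /(_ ik jk) E.
by rewrite -(subnKC i1) E subnKC.
Qed.

Variables (R : realType) (alpha : R).

Lemma Omega_wronskian :
  Omega alpha F1 F2 = wronskian alpha (#|` F1| + #|` F2|) seeds.
Proof.
rewrite /Omega /wronskian /laguerre_mx; congr (\det _); apply/matrixP => i j.
rewrite !mxE /seeds; case: splitP => h ->; rewrite mxE /seed_row //.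
by rewrite addKn.
Qed.

Lemma horner_root_poly_seeds y :
  (root_poly (seed_node alpha \o seeds) (#|` F1| + #|` F2|)).[y] =
  (\prod_(f <- F1) (y - f%:R)) * (\prod_(f <- F2) (y + (alpha + 1) + f%:R)).
Proof.
rewrite horner_prod big_split_ord /= -!(prod_fset_nth _ (fun f => y - f%:R)).
rewrite -(prod_fset_nth _ (fun f => y + (alpha + 1) + f%:R)).
congr (_ * _); apply: eq_bigr => i _; rewrite hornerXsubC /seeds /seed_node /=.
  by rewrite ltn_ord.
by rewrite ltnNge leq_addr addKn /= -opprD opprK addrA.
Qed.

End Seeds.

Theorem lemma6p2 (R : realType) (alpha : R) (F1 F2 : {fset nat})
    (halpha : forall n : nat, alpha != - n.+1%:R)
    (hF1 : forall f : nat, f \in F1 -> (0 < f)%N)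
    (hF2 : forall f : nat, f \in F2 -> (0 < f)%N)
    (hF : F1 != fset0 \/ F2 != fset0)
    (hadm : admissible (alpha + 1) F1 F2) :
  alpha + (#|` F1| + #|` F2|)%N%:R > -1 /\
  (forall x : R, 0 <= x -> (Omega alpha F1 F2).[x] != 0).
Proof.
have c_neq n : alpha + 1 + n%:R != 0.
  by rewrite -addrA nat1r addr_eq0 halpha.
have adm n : 0 <= pochhammer (alpha + 1) (chat (alpha + 1)) * pochhammer (alpha + 1) n *
    (root_poly (seed_node alpha \o seeds F1 F2) (#|` F1| + #|` F2|)).[n%:R].
  by rewrite horner_root_poly_seeds; apply: chat_quotient_ge0.
split.
  have := addr_chat_gt0 c_neq; have := chat_le_size c_neq adm.
  by rewrite -(ler_nat R); lra.
move=> x x0; rewrite Omega_wronskian.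
apply: (wronskian_neq0 c_neq (chat_tail c_neq)) => //; split=> //.
exact: seeds_inj.
Qed.
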